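(* For every computation $\{C_i\}_{i<\varphi}$ with $\varphi\in\mathbb{N}$ there is a $\mathsf{CNQ}$ computation $\{C'_i\}_{i<\xi}$ such that $C_0=C'_0$ and $C_{\varphi-1}=C'_{\xi-1}$.
   Context: The Q-calculus. Terms: classical variables $x$; quantum variables $r$; patterns $\pi::=x\mid\langle x_1,\dots,x_n\rangle$; constants $0,1$ and symbols $U_i$ for a fixed effective enumeration $(\mathbf{U}_i)$ of computable unitary operators on $\mathbb{C}^{2^{n_i}}$; terms $M::=x\mid r\mid\ !M\mid C\mid \mathtt{new}(M)\mid (M_1)M_2\mid\langle M_1,\dots,M_n\rangle\ (n\ge2)\mid \lambda!x.M\mid\lambda\pi.M$ modulo $\alpha$-conversion. Well-formedness of judgements $\Gamma\vdash M$: axioms $\vdash C$, $r\vdash r$, $x\vdash x$; $\Gamma\vdash M\Rightarrow\Gamma,!x\vdash M$; $\Gamma,!x,!y\vdash M\Rightarrow\Gamma,!z\vdash M\{z/x,z/y\}$; $!\Gamma\vdash M\Rightarrow!\Gamma\vdash!M$; $\Gamma,x\vdash M\Rightarrow\Gamma,!x\vdash M$; $\Gamma,x_1,\dots,x_k\vdash M\Rightarrow\Gamma,\langle x_1,\dots,x_k\rangle\vdash M$; $\Gamma_i\vdash M_i\Rightarrow\Gamma_1,\dots,\Gamma_k\vdash\langle M_1,\dots,M_k\rangle$; $\Gamma\vdash M\Rightarrow\Gamma\vdash\mathtt{new}(M)$; $\Gamma,\pi\vdash M\Rightarrow\Gamma\vdash\lambda\pi.M$; $\Gamma,!x\vdash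 M\Rightarrow\Gamma\vdash\lambda!x.M$; $\Gamma_1\vdash M_1,\Gamma_2\vdash M_2\Rightarrow\Gamma_1,\Gamma_2\vdash(M_1)M_2$. Configurations $[\mathcal{Q},\mathcal{QV},M]$ ($\mathcal{QV}$ finite set of quantum variables containing those of $M$, $\mathcal{Q}$ in the Hilbert space of functions $\{0,1\}^{\mathcal{QV}}\to\mathbb{C}$), modulo bijective renaming of quantum variables, assumed well formed. Labelled reductions: ($\mathsf{Uq}$) $[\mathcal{Q},\mathcal{QV},U\langle r_1,\dots,r_n\rangle]\to[\mathbf{U}_{\langle\langle r_1,\dots,r_n\rangle\rangle}\mathcal{Q},\mathcal{QV},\langle r_1,\dots,r_n\rangle]$ (apply $\mathbf{U}$ to qubits $r_1,\dots,r_n$); ($\mathsf{new}$) $[\mathcal{Q},\mathcal{QV},\mathtt{new}(c)]\to[\mathcal{Q}\otimes|r\mapsto c\rangle,\mathcal{QV}\cup\{r\},r]$, $c\in\{0,1\}$, $r$ fresh; and with $\mathcal{Q},\mathcal{QV}$ unchanged ($\mathsf{l.\beta}$) $(\lambda x.M)N\to M\{N/x\}$, ($\mathsf{q.\beta}$) $(\lambda\langle x_1,\dots,x_n\rangle.M)\langle r_1,\dots,r_n\rangle\to M\{r_i/x_i\}_i$, ($\mathsf{c.\beta}$) $(\lambda!x.M)!N\to M\{N/x\}$, ($\mathsf{l.cm}$) $L((\lambda\pi.M)N)\to(\lambda\pi.LM)N$, ($\mathsf{r.cm}$) $((\lambda\pi.M)N)L\to(\lambda\pi.ML)N$; closed (preserving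 labels) under tuple components, both sides of application, and the body of $\lambda\pi.(\cdot)$ (not inside $!M$). $\to$ is the union of all. Let $\mathscr{Q}=\{\mathsf{Uq},\mathsf{q.\beta}\}$, $n\mathscr{C}=\mathscr{Q}\cup\{\mathsf{new}\}$; for a set of labels $\mathscr{S}$, $\to_{\mathscr{S}}$ is the union of the reductions with labels in $\mathscr{S}$. A configuration is in normal form if it has no reduct. A computation of length $\varphi\le\omega$ is a sequence $\{C_i\}_{i<\varphi}$ with $C_{i-1}\to C_i$ for $0<i<\varphi$ and either $\varphi=\omega$ or $C_{\varphi-1}$ in normal form. A $\mathsf{CNQ}$ computation is a computation $\{C_i\}_{i<\varphi}$ such that for every $0<i<\varphi-1$: if $C_{i-1}\to_{n\mathscr{C}}C_i$ then $C_i\to_{n\mathscr{C}}C_{i+1}$, and if $C_{i-1}\to_{\mathscr{Q}}C_i$ then $C_i\to_{\mathscr{Q}}C_{i+1}$.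
   Formalization: Reduction is also closed under new(·) and the body of λ!x.(·), which the listed closure omits; without this the claim fails, e.g. for (λx.λ!y.x)(U⟨r1,r2⟩) and (λx.new(x))(U⟨r1,r2⟩), whose U-first computations cannot be reordered to CNQ. *)

(* Defs.v *)
From HB Require Import structures.
From mathcomp Require Import all_boot all_order all_algebra finmap.
From mathcomp Require Import reals complex.

Set Implicit Arguments.
Unset Strict Implicit.
Unset Printing Implicit Defensive.

Import GRing.Theory Num.Theory.

Local Open Scope nat_scope.

(* Terms are in de Bruijn form, so that equality of terms is equality modulo
   alpha-conversion: [lam PVar] and [lamb] bind the index 0, and
   [lam (PTup n)], for the pattern <x_1,...,x_n>, binds the indices
   0, ..., n-1, with x_k at index k-1. *)
Inductive pattern := PVar | PTup of nat.

Definition arity (p : pattern) : nat := if p is PTup n then n else 1.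

Inductive term :=
| var of nat              (* classical variable *)
| qvar of nat             (* quantum variable *)
| bang of term            (* !M *)
| bit of bool             (* 0, 1 *)
| gate of nat             (* U_i *)
| new of term
| app of term & term
| tup of seq term         (* <M_1,...,M_n>; [wf] imposes n >= 2 *)
| lamb of term            (* \!x.M *)
| lam of pattern & term.  (* \pi.M *)

Definition upren (n : nat) (f : nat -> nat) (k : nat) : nat :=
  if k < n then k else f (k - n) + n.

Fixpoint ren (f : nat -> nat) (M : term) : term :=
  match M with
  | var x => var (f x)
  | qvar r => qvar r
  | bang N => bang (ren f N)
  | bit b => bit b
  | gate i => gate i
  | new N => new (ren f N)
  | app N L => app (ren f N) (ren f L)
  | tup Ms => tup (map (ren f) Ms)
  | lamb N => lamb (ren (upren 1 f) N)
  | lam p N => lam p (ren (upren (arity p) f) N)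
  end.

Definition shift (n : nat) : term -> term := ren (addn^~ n).

Definition upsubst (n : nat) (s : nat -> term) (k : nat) : term :=
  if k < n then var k else shift n (s (k - n)).

Fixpoint subst (s : nat -> term) (M : term) : term :=
  match M with
  | var x => s x
  | qvar r => qvar r
  | bang N => bang (subst s N)
  | bit b => bit b
  | gate i => gate i
  | new N => new (subst s N)
  | app N L => app (subst s N) (subst s L)
  | tup Ms => tup (map (subst s) Ms)
  | lamb N => lamb (subst (upsubst 1 s) N)
  | lam p N => lam p (subst (upsubst (arity p) s) N)
  end.

(* [inst Ns M] replaces the outermost bound indices 0, ..., size Ns - 1 of the
   body M of an abstraction by the terms Ns, and removes the binder. *)
Definition inst (Ns : seq term) : term -> term :=
  subst (fun k => nth (var (k - size Ns)) Ns k).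

Fixpoint qren (th : nat -> nat) (M : term) : term :=
  match M with
  | var x => var x
  | qvar r => qvar (th r)
  | bang N => bang (qren th N)
  | bit b => bit b
  | gate i => gate i
  | new N => new (qren th N)
  | app N L => app (qren th N) (qren th L)
  | tup Ms => tup (map (qren th) Ms)
  | lamb N => lamb (qren th N)
  | lam p N => lam p (qren th N)
  end.

Fixpoint qvars (M : term) : seq nat :=
  match M with
  | var _ | bit _ | gate _ => [::]
  | qvar r => [:: r]
  | bang N | new N | lamb N | lam _ N => qvars N
  | app N L => qvars N ++ qvars L
  | tup Ms => flatten (map qvars Ms)
  end.

Inductive entry :=
| ELin of nat       (* x *)
| EBang of nat      (* !x *)
| EPat of seq nat   (* <x_1,...,x_n> *)
| EQ of nat.        (* r *)

Definition entry_eq_dec (e1 e2 : entry) : {e1 = e2} + {e1 <> e2}.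
Proof. by decide equality; apply: eq_comparable. Defined.

HB.instance Definition _ := comparableMixin entry_eq_dec.

Definition env := seq entry.

Definition entry_cvars (e : entry) : seq nat :=
  match e with
  | ELin x | EBang x => [:: x]
  | EPat xs => xs
  | EQ _ => [::]
  end.

Definition entry_qvars (e : entry) : seq nat := if e is EQ r then [:: r] else [::].

(* Every variable occurs at most once in an environment. *)
Definition env_ok (G : env) : bool :=
  uniq (flatten (map entry_cvars G)) && uniq (flatten (map entry_qvars G)).

Definition shift_entry (n : nat) (e : entry) : entry :=
  match e with
  | ELin x => ELin (x + n)
  | EBang x => EBang (x + n)
  | EPat xs => EPat (map (addn^~ n) xs)
  | EQ r => EQ r
  end.

Definition pat_entry (p : pattern) : entry :=
  if p is PTup n then EPat (iota 0 n) else ELin 0.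

(* Well-formed judgements.  Environments are finite sets, hence [wf_exch]; a
   comma is the union of environments without common variables, which is the
   role of [env_ok].  The free classical variables of a term are named by their
   de Bruijn indices, so an environment is shifted when a binder is entered. *)
Inductive wf : env -> term -> Prop :=
| wf_exch G D M : perm_eq G D -> wf G M -> wf D M
| wf_bit b : wf [::] (bit b)
| wf_gate i : wf [::] (gate i)
| wf_qvar r : wf [:: EQ r] (qvar r)
| wf_var x : wf [:: ELin x] (var x)
| wf_weak G x M :
    env_ok (EBang x :: G) -> wf G M -> wf (EBang x :: G) M
| wf_contr G x y z M :
    env_ok (EBang z :: G) -> wf (EBang x :: EBang y :: G) M ->
    wf (EBang z :: G) (ren (fun k => if k \in [:: x; y] then z else k) M)
| wf_prom xs M :
    wf (map EBang xs) M -> wf (map EBang xs) (bang M)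
| wf_der G x M : wf (ELin x :: G) M -> wf (EBang x :: G) M
| wf_pat G xs M :
    2 <= size xs -> wf (map ELin xs ++ G) M -> wf (EPat xs :: G) M
| wf_tup (GMs : seq (env * term)) :
    2 <= size GMs -> env_ok (flatten (unzip1 GMs)) ->
    (forall k, k < size GMs ->
       wf (nth [::] (unzip1 GMs) k) (nth (bit false) (unzip2 GMs) k)) ->
    wf (flatten (unzip1 GMs)) (tup (unzip2 GMs))
| wf_new G M : wf G M -> wf G (new M)
| wf_lam G p M :
    wf (pat_entry p :: map (shift_entry (arity p)) G) M -> wf G (lam p M)
| wf_lamb G M :
    wf (EBang 0 :: map (shift_entry 1) G) M -> wf G (lamb M)
| wf_app G1 G2 M1 M2 :
    env_ok (G1 ++ G2) -> wf G1 M1 -> wf G2 M2 -> wf (G1 ++ G2) (app M1 M2).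

(* The total recursive functions: the closure of the basic functions under
   composition, primitive recursion and minimization of regular functions.
   Arguments are passed as a list, missing ones counting as 0. *)
Inductive recursive : (seq nat -> nat) -> Prop :=
| rec_zero : recursive (fun=> 0)
| rec_succ : recursive (fun v => (head 0 v).+1)
| rec_proj i : recursive (fun v => nth 0 v i)
| rec_comp f (gs : seq (seq nat -> nat)) :
    recursive f ->
    (forall k, k < size gs -> recursive (nth (fun=> 0) gs k)) ->
    recursive (fun v => f [seq g v | g <- gs])
| rec_prim f g :
    recursive f -> recursive g ->
    recursive (fun v =>
      nat_rect (fun=> nat) (f (behead v))
        (fun m acc => g (m :: acc :: behead v)) (head 0 v))
| rec_mu f g :
    recursive f ->
    (forall v, f (g v :: v) = 0 /\ forall y, y < g v -> f (y :: v) <> 0) ->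
    recursive g.

Section Calculus.
Local Open Scope ring_scope.
Local Open Scope complex_scope.
Local Open Scope fset_scope.
Variable R : realType.

(* (p - q) / 2^m approximates x up to 2^-m. *)
Definition approx (x : R) (p q m : nat) : Prop :=
  `| x - (p%:R - q%:R) / 2 ^+ m | <= (2 ^+ m)^-1.

(* The entries of U_i are computable complex numbers, uniformly in i. *)
Definition effective_enumeration
    (nq : nat -> nat) (U : forall i, 'M[R[i]]_(2 ^ nq i)) : Prop :=
  (exists2 a, recursive a & forall i, a [:: i] = nq i) /\
  exists p q p' q' : seq nat -> nat,
    [/\ recursive p, recursive q, recursive p', recursive q' &
      forall i (j k : 'I_(2 ^ nq i)) (m : nat),
        let v := [:: i; j : nat; k : nat; m] in
        approx (complex.Re (U i j k)) (p v) (q v) m /\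
        approx (complex.Im (U i j k)) (p' v) (q' v) m].

(* The Hilbert space of functions {0,1}^V -> C. *)
Definition hilbert (V : {fset nat}) : Type := {ffun {ffun V -> bool} -> R[i]}.

Record qstate := QState { qv : {fset nat}; reg : hilbert qv }.

(* An element of {0,1}^V is handled as an assignment of all quantum variables:
   [res V] restricts to V, [ext] extends (by an irrelevant value). *)
Definition res (V : {fset nat}) (a : nat -> bool) : {ffun V -> bool} :=
  [ffun x => a (val x)].
Definition ext (V : {fset nat}) (f : {ffun V -> bool}) (r : nat) : bool :=
  if insub r is Some x then f x else false.

(* The basis vector |b_1 ... b_n> of C^(2^n) is the one whose index is written
   b_1 ... b_n in binary. *)
Definition code_nat (bs : seq bool) : nat :=
  foldl (fun k (b : bool) => (k.*2 + b)%N) 0%N bs.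

Lemma code_nat_lt (bs : seq bool) : (code_nat bs < 2 ^ size bs)%N.
Proof.
rewrite /code_nat; elim/last_ind: bs => [|bs b IH] //.
rewrite -cats1 foldl_cat size_cat /= addn1 expnS mul2n.
by case: b; rewrite ?addn1 ?addn0 ?ltn_Sdouble ?ltn_double.
Qed.

Lemma code_lt (n : nat) (b : n.-tuple bool) : (code_nat b < 2 ^ n)%N.
Proof. by have := code_nat_lt b; rewrite size_tuple. Qed.

Definition code (n : nat) (b : n.-tuple bool) : 'I_(2 ^ n) := Ordinal (code_lt b).

Definition update (a : nat -> bool) (rs : seq nat) (bs : seq bool) : nat -> bool :=
  fun r => if r \in rs then nth false bs (index r rs) else a r.

(* A acting on the qubits rs = r_1, ..., r_n, and as the identity on the
   others. *)
Definition apply_op (n : nat) (A : 'M[R[i]]_(2 ^ n)) (rs : n.-tuple nat)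
    (S : qstate) : qstate :=
  QState [ffun f : {ffun qv S -> bool} =>
    \sum_(b : n.-tuple bool)
      A (code [tuple of map (ext f) rs]) (code b) *
      reg S (res (qv S) (update (ext f) rs b))].

(* Q (x) |r |-> c> *)
Definition add_qubit (S : qstate) (r : nat) (c : bool) : qstate :=
  QState [ffun f : {ffun (r |` qv S) -> bool} =>
    reg S (res (qv S) (ext f)) * (ext f r == c)%:R].

Inductive label := Uq | New | Lbeta | Qbeta | Cbeta | Lcm | Rcm.

Definition label_Q (a : label) : bool :=
  match a with Uq | Qbeta => true | _ => false end.
Definition label_nC (a : label) : bool :=
  match a with New => true | _ => label_Q a end.

Section Reduction.
Variables (nq : nat -> nat) (U : forall i, 'M[R[i]]_(2 ^ nq i)).

(* Reduction takes place everywhere except inside !M.  It has to include the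
   argument of new and the body of \!x: otherwise
   (\x.\!y.x)(U<r_1,r_2>) and (\x.new(x))(U<r_1,r_2>) would have two distinct
   normal forms each, the one obtained by firing U first being out of reach of
   a computation that postpones the quantum steps. *)
Inductive red : label -> qstate -> term -> qstate -> term -> Prop :=
| red_Uq S i (rs : (nq i).-tuple nat) :
    red Uq S (app (gate i) (tup (map qvar rs)))
        (apply_op (U i) rs S) (tup (map qvar rs))
| red_new S c r :
    r \notin qv S -> red New S (new (bit c)) (add_qubit S r c) (qvar r)
| red_Lbeta S M N : red Lbeta S (app (lam PVar M) N) S (inst [:: N] M)
| red_Qbeta S M (rs : seq nat) :
    red Qbeta S (app (lam (PTup (size rs)) M) (tup (map qvar rs)))
        S (inst (map qvar rs) M)
| red_Cbeta S M N : red Cbeta S (app (lamb M) (bang N)) S (inst [:: N] M)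
| red_Lcm S L p M N :
    red Lcm S (app L (app (lam p M) N)) S (app (lam p (app (shift (arity p) L) M)) N)
| red_Rcm S L p M N :
    red Rcm S (app (app (lam p M) N) L) S (app (lam p (app M (shift (arity p) L))) N)
| red_tup a S S' M M' (Ms1 Ms2 : seq term) :
    red a S M S' M' -> red a S (tup (Ms1 ++ M :: Ms2)) S' (tup (Ms1 ++ M' :: Ms2))
| red_appl a S S' M M' N : red a S M S' M' -> red a S (app M N) S' (app M' N)
| red_appr a S S' M N N' : red a S N S' N' -> red a S (app M N) S' (app M N')
| red_in_new a S S' M M' : red a S M S' M' -> red a S (new M) S' (new M')
| red_in_lamb a S S' M M' : red a S M S' M' -> red a S (lamb M) S' (lamb M')
| red_in_lam a S S' p M M' : red a S M S' M' -> red a S (lam p M) S' (lam p M').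

Record preconfig := Preconfig { st : qstate; tm : term }.

Definition well_formed (C : preconfig) : Prop :=
  {subset qvars (tm C) <= qv (st C)} /\ exists G, wf G (tm C).

Record config := Config { pre :> preconfig; configP : well_formed pre }.

(* Equality of configurations: D is C up to the bijective renaming th of its
   quantum variables. *)
Definition cequiv (C D : preconfig) : Prop :=
  exists th : nat -> nat,
    [/\ {in qv (st C) &, injective th},
        qv (st D) = [fset th r | r in qv (st C)],
        forall a : nat -> bool,
          reg (st D) (res (qv (st D)) a) = reg (st C) (res (qv (st C)) (a \o th)) &
        tm D = qren th (tm C)].

Definition step_in (P : pred label) (C D : config) : Prop :=
  exists (a : label) (C1 D1 : preconfig),
    [/\ P a, cequiv C C1, red a (st C1) (tm C1) (st D1) (tm D1) & cequiv D1 D].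

Definition step : config -> config -> Prop := step_in predT.

Definition normal (C : config) : Prop := ~ exists D, step C D.

(* Lengths phi <= omega: [None] stands for omega. *)
Definition lt_length (i : nat) (phi : option nat) : bool :=
  if phi is Some n then (i < n)%N else true.

(* The terms of C of index >= phi are irrelevant. *)
Definition computation (phi : option nat) (C : nat -> config) : Prop :=
  (forall i, (0 < i)%N -> lt_length i phi -> step (C i.-1) (C i)) /\
  (if phi is Some n then (0 < n)%N /\ normal (C n.-1) else True).

Definition CNQ_computation (phi : option nat) (C : nat -> config) : Prop :=
  computation phi C /\
  forall i, (0 < i)%N -> lt_length i.+1 phi ->
    (step_in label_nC (C i.-1) (C i) -> step_in label_nC (C i) (C i.+1)) /\
    (step_in label_Q (C i.-1) (C i) -> step_in label_Q (C i) (C i.+1)).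

End Reduction.
End Calculus.

(* Main.v *)
From Stdlib Require List.
Require Import Defs.
From mathcomp Require Import all_boot all_order all_algebra finmap zify.
From mathcomp Require Import reals complex.

Set Implicit Arguments.
Unset Strict Implicit.
Unset Printing Implicit Defensive.

Import GRing.Theory Num.Theory.

Local Open Scope nat_scope.

(* No confluence or termination argument is needed: a finite computation is
   sorted, as in bubble sort, into classical steps, then new steps, then quantum
   steps, with the same endpoints.

   A classical step that follows a quantum or new step can be fired before it.
   The only redexes at stake are those created by contracting a tuple redex
   (\<x_1,...,x_n>.P)<r_1,...,r_n>, and they arise between its reduct and its
   context; but commuting conversions bring the context into P, where these
   redexes exist already, because substituting quantum variables for variables
   creates no classical redex.  Moreover the postponed step is neither erased nor
   duplicated, since linear variables occur exactly once and no reduction takes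
   place under !.  In the same way a new step that follows a quantum step can be
   fired before it: linearity prevents a tuple redex from reducing to a bit.

   The intermediate terms must be well-formed.  Since variables are free to be
   declared duplicable, a term is well-formed in some environment if and only if
   its bound linear variables and its quantum variables occur linearly; this
   condition is preserved by reduction.

   Finally, the CNQ condition mentions the existence of a step of some kind
   between two consecutive configurations, and not the step that was chosen; so
   one has to see that steps of different kinds have different outcomes, which is
   shown by counting nodes. *)

(** * Induction over terms with nested tuples *)

Section TermInduction.
Variable P : term -> Prop.
Hypotheses (Pvar : forall x, P (var x)) (Pqvar : forall r, P (qvar r)).
Hypotheses (Pbit : forall b, P (bit b)) (Pgate : forall i, P (gate i)).
Hypothesis Pbang : forall M, P M -> P (bang M).
Hypothesis Pnew : forall M, P M -> P (new M).
Hypothesis Papp : forall M N, P M -> P N -> P (app M N).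
Hypothesis Plamb : forall M, P M -> P (lamb M).
Hypothesis Plam : forall p M, P M -> P (lam p M).

(** The components of a tuple sit inside a list, so the explicit fixpoint supplies their induction
    hypotheses. *)
Lemma term_Forall_ind :
  (forall Ms, List.Forall P Ms -> P (tup Ms)) -> forall M, P M.
Proof.
move=> Ptup; fix IH 1; case.
- exact: Pvar.
- exact: Pqvar.
- by move=> M; apply: Pbang.
- exact: Pbit.
- exact: Pgate.
- by move=> M; apply: Pnew.
- by move=> M N; apply: Papp.
- by move=> Ms; apply: Ptup; elim: Ms => [|M Ms IHs]; constructor.
- by move=> M; apply: Plamb.
- by move=> p M; apply: Plam.
Qed.

(** Functions on tuples are computed component by component, so the tail of a tuple can serve as a
    term in its own right, even when it is too short to be well formed. In proofs by rewriting this
    replaces a nested induction on the list. *)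
Lemma term_cons_ind :
  P (tup [::]) -> (forall M Ms, P M -> P (tup Ms) -> P (tup (M :: Ms))) ->
  forall M, P M.
Proof.
move=> P0 Pcons; apply: term_Forall_ind => Ms; elim=> // M Ms' PM _.
exact: Pcons.
Qed.

End TermInduction.

(** * Occurrences of variables *)

(* An occurrence is a variable together with a flag telling whether it lies
   under some !. *)
Definition mark (b : bool) (l : seq (bool * nat)) :=
  [seq (b || p.1, p.2) | p <- l].

(** Leaving the scope of [n] bound indices: bound occurrences are dropped, and the others recover
    their outer index. *)
Definition down (n : nat) (l : seq (bool * nat)) :=
  [seq (p.1, p.2 - n) | p <- l & n <= p.2].

Fixpoint cocc (M : term) : seq (bool * nat) :=
  match M with
  | var x => [:: (false, x)]
  | qvar _ | bit _ | gate _ => [::]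
  | bang N => mark true (cocc N)
  | new N => cocc N
  | app N L => cocc N ++ cocc L
  | tup Ms => flatten (map cocc Ms)
  | lamb N => down 1 (cocc N)
  | lam p N => down (arity p) (cocc N)
  end.

Fixpoint qocc (M : term) : seq (bool * nat) :=
  match M with
  | qvar r => [:: (false, r)]
  | var _ | bit _ | gate _ => [::]
  | bang N => mark true (qocc N)
  | new N | lamb N | lam _ N => qocc N
  | app N L => qocc N ++ qocc L
  | tup Ms => flatten (map qocc Ms)
  end.

Lemma qvarsE M : qvars M = unzip2 (qocc M).
Proof.
elim/term_cons_ind: M => //= [M ->|M N -> ->|M Ms -> /= ->].
- by rewrite /mark /unzip2 -map_comp.
- by rewrite /unzip2 map_cat.
- by rewrite /unzip2 map_cat.
Qed.

Lemma mark_cat b l1 l2 : mark b (l1 ++ l2) = mark b l1 ++ mark b l2.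
Proof. exact: map_cat. Qed.

Lemma mark_mark b c l : mark b (mark c l) = mark (b || c) l.
Proof. by rewrite /mark -map_comp; apply: eq_map => p /=; rewrite orbA. Qed.

Lemma map_mark T (F : bool * nat -> T) b l :
  map F (mark b l) = [seq F (b || p.1, p.2) | p <- l].
Proof. by rewrite /mark -map_comp. Qed.

Lemma mark0 l : mark false l = l.
Proof. by rewrite /mark -[RHS]map_id; apply: eq_map => -[]. Qed.

Lemma mark_flatten b ls : mark b (flatten ls) = flatten (map (mark b) ls).
Proof. exact: map_flatten. Qed.

Lemma down_cat n l1 l2 : down n (l1 ++ l2) = down n l1 ++ down n l2.
Proof. by rewrite /down filter_cat map_cat. Qed.

Lemma down_cons n p l :
  down n (p :: l) = if n <= p.2 then (p.1, p.2 - n) :: down n l else down n l.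
Proof. by rewrite /down /=; case: ifP. Qed.

Lemma down_mark n b l : down n (mark b l) = mark b (down n l).
Proof. by rewrite /down /mark filter_map -!map_comp. Qed.

Lemma mem_down n l b x : ((b, x) \in down n l) = ((b, x + n) \in l).
Proof.
apply/mapP/idP => [[[c y]]|xl].
  by rewrite mem_filter => /andP[/= ny yl] [-> ->]; rewrite subnK.
by exists (b, x + n); rewrite ?mem_filter /= ?leq_addl ?addnK.
Qed.

Lemma mem_mark b l c x :
  ((c, x) \in mark b l) -> exists d, (d, x) \in l.
Proof. by case/mapP=> [[d y] yl [_ ->]]; exists d. Qed.

Lemma mem_mark1 b l c x :
  ((c, x) \in l) -> (b || c, x) \in mark b l.
Proof. by move=> xl; apply/mapP; exists (c, x). Qed.

Definition map_snd (f : nat -> nat) (l : seq (bool * nat)) :=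
  [seq (p.1, f p.2) | p <- l].

(** * Algebra of renaming and substitution *)

Lemma upren_lt n f k : k < n -> upren n f k = k.
Proof. by rewrite /upren => ->. Qed.

Lemma upren_ge n f k : upren n f (k + n) = f k + n.
Proof. by rewrite /upren ltnNge leq_addl addnK. Qed.

Lemma upsubst_lt n s k : k < n -> upsubst n s k = var k.
Proof. by rewrite /upsubst => ->. Qed.

Lemma upsubst_ge n s k : upsubst n s (k + n) = shift n (s k).
Proof. by rewrite /upsubst ltnNge leq_addl addnK. Qed.

(** The recurrent case analysis under a binder: an index is either bound there or the shift of an
    outer index. *)
Lemma ltn_addP n k : (k < n) + {j | k = j + n}.
Proof. by case: (ltnP k n) => nk; [left | right; exists (k - n); rewrite subnK]. Qed.

Lemma eq_in_ren f g M :
  (forall b x, (b, x) \in cocc M -> f x = g x) -> ren f M = ren g M.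
Proof.
elim/term_cons_ind: M f g => //=.
- by move=> x f g fg; rewrite (fg false) ?mem_head.
- by move=> M IH f g fg; congr bang; apply: IH => b x /(mem_mark1 true)/fg.
- by move=> M IH f g fg; congr new; apply: IH.
- move=> M N IHM IHN f g fg; congr app.
    by apply: IHM => b x xM; apply: (fg b); rewrite mem_cat xM.
  by apply: IHN => b x xN; apply: (fg b); rewrite mem_cat xN orbT.
- move=> M IH f g fg; congr lamb; apply: IH => b x.
  case: (ltn_addP 1 x) => [x0|[y ->]]; first by rewrite !upren_lt.
  by rewrite !upren_ge -mem_down => /fg ->.
- move=> p M IH f g fg; congr lam; apply: IH => b x.
  case: (ltn_addP (arity p) x) => [x0|[y ->]]; first by rewrite !upren_lt.
  by rewrite !upren_ge -mem_down => /fg ->.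
- move=> M Ms IHM IHMs f g fg.
  have /(IHMs f g)[->] : forall b x, (b, x) \in flatten (map cocc Ms) -> f x = g x.
    by move=> b x xMs; apply: (fg b); rewrite mem_cat xMs orbT.
  by rewrite (IHM f g) // => b x xM; apply: (fg b); rewrite mem_cat xM.
Qed.

Lemma eq_ren f g M : f =1 g -> ren f M = ren g M.
Proof. by move=> fg; apply: eq_in_ren. Qed.

Lemma eq_in_subst s t M :
  (forall b x, (b, x) \in cocc M -> s x = t x) -> subst s M = subst t M.
Proof.
elim/term_cons_ind: M s t => //=.
- by move=> x f g fg; rewrite (fg false) ?mem_head.
- by move=> M IH f g fg; congr bang; apply: IH => b x /(mem_mark1 true)/fg.
- by move=> M IH f g fg; congr new; apply: IH.
- move=> M N IHM IHN f g fg; congr app.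
    by apply: IHM => b x xM; apply: (fg b); rewrite mem_cat xM.
  by apply: IHN => b x xN; apply: (fg b); rewrite mem_cat xN orbT.
- move=> M IH f g fg; congr lamb; apply: IH => b x.
  case: (ltn_addP 1 x) => [x0|[y ->]]; first by rewrite !upsubst_lt.
  by rewrite !upsubst_ge -mem_down => /fg ->.
- move=> p M IH f g fg; congr lam; apply: IH => b x.
  case: (ltn_addP (arity p) x) => [x0|[y ->]]; first by rewrite !upsubst_lt.
  by rewrite !upsubst_ge -mem_down => /fg ->.
- move=> M Ms IHM IHMs f g fg.
  have /(IHMs f g)[->] : forall b x, (b, x) \in flatten (map cocc Ms) -> f x = g x.
    by move=> b x xMs; apply: (fg b); rewrite mem_cat xMs orbT.
  by rewrite (IHM f g) // => b x xM; apply: (fg b); rewrite mem_cat xM.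
Qed.

Lemma eq_subst s t M : s =1 t -> subst s M = subst t M.
Proof. by move=> st; apply: eq_in_subst. Qed.

Lemma upsubst_var n f : upsubst n (var \o f) =1 var \o upren n f.
Proof.
move=> k; case: (ltn_addP n k) => [kn|[j ->]] /=; first by rewrite upsubst_lt // upren_lt.
by rewrite upsubst_ge upren_ge.
Qed.

Lemma renE f M : ren f M = subst (var \o f) M.
Proof.
elim/term_cons_ind: M f => //= [M IH f|M IH f|M N IHM IHN f|M IH f|p M IH f|M Ms IHM IHMs f].
- by rewrite IH.
- by rewrite IH.
- by rewrite IHM IHN.
- by rewrite IH -(eq_subst _ (upsubst_var _ _)).
- by rewrite IH -(eq_subst _ (upsubst_var _ _)).
- by rewrite IHM; case: (IHMs f) => ->.
Qed.

Lemma subst_var M : subst var M = M.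
Proof.
have up n : upsubst n var =1 var.
  move=> k; case: (ltn_addP n k) => [kn|[j ->]]; first by rewrite upsubst_lt.
  by rewrite upsubst_ge.
elim/term_cons_ind: M => //= [M ->|M ->|M N -> ->|M IH|p M IH|M Ms -> [->]] //.
- by rewrite (eq_subst _ (up _)) IH.
- by rewrite (eq_subst _ (up _)) IH.
Qed.

Lemma ren_id_in f M :
  (forall b x, (b, x) \in cocc M -> f x = x) -> ren f M = M.
Proof. by move=> /eq_in_ren ->; rewrite renE subst_var. Qed.

Lemma upren_comp n f g : upren n f \o upren n g =1 upren n (f \o g).
Proof.
move=> k /=; case: (ltn_addP n k) => [kn|[j ->]]; first by rewrite !upren_lt.
by rewrite !upren_ge.
Qed.

Lemma ren_ren f g M : ren f (ren g M) = ren (f \o g) M.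
Proof.
elim/term_cons_ind: M f g => //= [M IH f g|M IH f g|M N IHM IHN f g|M IH f g|p M IH f g|M Ms IHM IHMs f g].
- by rewrite IH.
- by rewrite IH.
- by rewrite IHM IHN.
- by rewrite IH (eq_ren _ (upren_comp _ _ _)).
- by rewrite IH (eq_ren _ (upren_comp _ _ _)).
- by rewrite IHM; case: (IHMs f g) => ->.
Qed.

Lemma subst_ren s f M : subst s (ren f M) = subst (s \o f) M.
Proof.
have up n t g : upsubst n t \o upren n g =1 upsubst n (t \o g).
  move=> k /=; case: (ltn_addP n k) => [kn|[j ->]]; first by rewrite upren_lt // !upsubst_lt.
  by rewrite upren_ge !upsubst_ge.
elim/term_cons_ind: M s f => //= [M IH f g|M IH f g|M N IHM IHN f g|M IH f g|p M IH f g|M Ms IHM IHMs f g].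
- by rewrite IH.
- by rewrite IH.
- by rewrite IHM IHN.
- by rewrite IH (eq_subst _ (up _ _ _)).
- by rewrite IH (eq_subst _ (up _ _ _)).
- by rewrite IHM; case: (IHMs f g) => ->.
Qed.

Lemma ren_shift n f M : ren (upren n f) (shift n M) = shift n (ren f M).
Proof. by rewrite /shift !ren_ren; apply: eq_ren => k /=; rewrite upren_ge. Qed.

Lemma ren_subst f s M : ren f (subst s M) = subst (ren f \o s) M.
Proof.
have up n g t : ren (upren n g) \o upsubst n t =1 upsubst n (ren g \o t).
  move=> k /=; case: (ltn_addP n k) => [kn|[j ->]].
    by rewrite !upsubst_lt //= upren_lt.
  by rewrite !upsubst_ge ren_shift.
elim/term_cons_ind: M f s => //= [M IH f g|M IH f g|M N IHM IHN f g|M IH f g|p M IH f g|M Ms IHM IHMs f g].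
- by rewrite IH.
- by rewrite IH.
- by rewrite IHM IHN.
- by rewrite IH (eq_subst _ (up _ _ _)).
- by rewrite IH (eq_subst _ (up _ _ _)).
- by rewrite IHM; case: (IHMs f g) => ->.
Qed.

Lemma subst_shift n s M : subst (upsubst n s) (shift n M) = shift n (subst s M).
Proof.
by rewrite /shift subst_ren ren_subst; apply: eq_subst => k /=; rewrite upsubst_ge.
Qed.

Lemma subst_subst s t M : subst s (subst t M) = subst (subst s \o t) M.
Proof.
have up n g u : subst (upsubst n g) \o upsubst n u =1 upsubst n (subst g \o u).
  move=> k /=; case: (ltn_addP n k) => [kn|[j ->]].
    by rewrite !upsubst_lt //= upsubst_lt.
  by rewrite !upsubst_ge subst_shift.
elim/term_cons_ind: M s t => //= [M IH f g|M IH f g|M N IHM IHN f g|M IH f g|p M IH f g|M Ms IHM IHMs f g].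
- by rewrite IH.
- by rewrite IH.
- by rewrite IHM IHN.
- by rewrite IH (eq_subst _ (up _ _ _)).
- by rewrite IH (eq_subst _ (up _ _ _)).
- by rewrite IHM; case: (IHMs f g) => ->.
Qed.

Lemma inst_shift n Ns M : n = size Ns -> inst Ns (shift n M) = M.
Proof.
move=> ->; rewrite /inst /shift subst_ren -[RHS]subst_var; apply: eq_subst => k /=.
by rewrite nth_default ?leq_addl // addnK.
Qed.

Lemma subst_inst s Ns M :
  subst s (inst Ns M) = inst (map (subst s) Ns) (subst (upsubst (size Ns) s) M).
Proof.
rewrite /inst !subst_subst size_map; apply: eq_subst => k /=.
case: (ltn_addP (size Ns) k) => [kn|[j ->]].
  by rewrite upsubst_lt //= !(nth_map (var (k - size Ns))) // (set_nth_default (var (k - size Ns))).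
rewrite upsubst_ge nth_default ?leq_addl //= addnK -[LHS](@inst_shift (size Ns) (map (subst s) Ns)) ?size_map //.
by rewrite /inst size_map.
Qed.

(** * Occurrences in renamed and substituted terms *)

Lemma cocc_ren f M : cocc (ren f M) = map_snd f (cocc M).
Proof.
have up n g l : down n (map_snd (upren n g) l) = map_snd g (down n l).
  elim: l => //= -[b k] l IH; rewrite !down_cons IH /=.
  case: (ltn_addP n k) => [kn|[j ->]]; last by rewrite upren_ge !leq_addl /= !addnK.
  by rewrite upren_lt // leqNgt kn.
elim/term_cons_ind: M f => //= [M IH f|M N IHM IHN f|M IH f|p M IH f|M Ms IHM IHMs f].
- by rewrite IH /mark /map_snd -!map_comp.
- by rewrite IHM IHN /map_snd map_cat.
- by rewrite IH up.
- by rewrite IH up.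
- by rewrite IHM IHMs /map_snd map_cat.
Qed.

Lemma qocc_ren f M : qocc (ren f M) = qocc M.
Proof.
by elim/term_cons_ind: M f => //= [M IH f|M N IHM IHN f|M Ms IHM IHMs f];
  rewrite ?IH ?IHM ?IHN ?IHMs.
Qed.

Lemma down_shift n M : down n (cocc (shift n M)) = cocc M.
Proof.
rewrite /shift cocc_ren /down /map_snd filter_map -map_comp (eq_filter (a2 := predT)).
  by rewrite filter_predT -[RHS]map_id; apply: eq_map => -[b k] /=; rewrite addnK.
by move=> [b k] /=; rewrite leq_addl.
Qed.

Lemma cocc_subst s M :
  cocc (subst s M) = flatten [seq mark p.1 (cocc (s p.2)) | p <- cocc M].
Proof.
have up n t l : down n (flatten [seq mark p.1 (cocc (upsubst n t p.2)) | p <- l]) =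
    flatten [seq mark p.1 (cocc (t p.2)) | p <- down n l].
  elim: l => //= -[b k] l IH; rewrite down_cat IH down_cons down_mark /=.
  case: (ltn_addP n k) => [kn|[j ->]].
    by rewrite upsubst_lt //= down_cons /= leqNgt kn.
  by rewrite leq_addl /= addnK upsubst_ge down_shift.
elim/term_cons_ind: M s => //= [x s|M IH s|M N IHM IHN s|M IH s|p M IH s|M Ms IHM IHMs s].
- by rewrite cats0 mark0.
- rewrite IH mark_flatten -map_comp map_mark; congr flatten.
  by apply: eq_map => p /=; rewrite mark_mark.
- by rewrite IHM IHN map_cat flatten_cat.
- by rewrite IH up.
- by rewrite IH up.
- by rewrite IHM IHMs map_cat flatten_cat.
Qed.

(** Only a permutation, because the quantum variables brought in by [s] are interleaved with those
    of [M]. *)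
Lemma qocc_subst s M :
  perm_eq (qocc (subst s M))
    (qocc M ++ flatten [seq mark p.1 (qocc (s p.2)) | p <- cocc M]).
Proof.
have up n t l : flatten [seq mark p.1 (qocc (upsubst n t p.2)) | p <- l] =
    flatten [seq mark p.1 (qocc (t p.2)) | p <- down n l].
  elim: l => //= -[b k] l IH; rewrite IH down_cons /=.
  case: (ltn_addP n k) => [kn|[j ->]]; first by rewrite upsubst_lt // leqNgt kn.
  by rewrite leq_addl /= addnK upsubst_ge /shift qocc_ren.
have cat4 (T : eqType) (a b c d A B : seq T) :
    perm_eq A (a ++ b) -> perm_eq B (c ++ d) -> perm_eq (A ++ B) ((a ++ c) ++ (b ++ d)).
  move=> HA HB; apply: (perm_trans (perm_cat HA HB)).
  by rewrite -!catA perm_cat2l perm_catCA.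
elim/term_cons_ind: M s => //= [x s|M IH s|M N IHM IHN s|M IH s|p M IH s|M Ms IHM IHMs s].
- by rewrite cats0 mark0.
- apply: (perm_trans (perm_map _ (IH s))); rewrite -/(mark _ _) mark_cat mark_flatten.
  rewrite map_mark -map_comp perm_cat2l.
  by rewrite (eq_map (g := fun p => mark (true || p.1) (qocc (s p.2)))) // => p /=; rewrite mark_mark.
- by rewrite map_cat flatten_cat; apply: cat4.
- by rewrite -up.
- by rewrite -up.
- by rewrite map_cat flatten_cat; apply: cat4.
Qed.

Definition occs (k : nat) (l : seq (bool * nat)) := [seq p <- l | p.2 == k].

(** * Linearity *)

Definition lin (k : nat) (M : term) : bool := occs k (cocc M) == [:: (false, k)].

(** Besides the sizes of tuples and patterns, only the variables bound by [lam] are constrained: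
    each has a single occurrence, outside every [bang] (the flag [false] in [lin]). Free variables
    and those bound by [lamb] are unrestricted. *)
Fixpoint linear_term (M : term) : bool :=
  match M with
  | bang N | new N | lamb N => linear_term N
  | app N L => linear_term N && linear_term L
  | tup Ms => (1 < size Ms) && all linear_term Ms
  | lam p N => [&& (if p is PTup n then 1 < n else true),
                  all (fun k => lin k N) (iota 0 (arity p)) & linear_term N]
  | _ => true
  end.

(* Equivalent to well-formedness in some environment ([wf_good], [good_wf]). *)
Definition good (M : term) : bool :=
  [&& linear_term M, all (fun p => ~~ p.1) (qocc M) & uniq (qvars M)].

Lemma occs_cat k l1 l2 : occs k (l1 ++ l2) = occs k l1 ++ occs k l2.
Proof. exact: filter_cat. Qed.

Lemma occs_mark k b l : occs k (mark b l) = mark b (occs k l).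
Proof. by rewrite /occs /mark filter_map. Qed.

Lemma occs_flatten k ls : occs k (flatten ls) = flatten (map (occs k) ls).
Proof. exact: filter_flatten. Qed.

Lemma occs_down k n l : occs k (down n l) = map_snd (subn^~ n) (occs (k + n) l).
Proof.
elim: l => //= -[b j] l IH; rewrite down_cons /=.
case: (ltn_addP n j) => [jn|[i ->]].
  rewrite leqNgt jn /= IH; case: eqP => // jk; move: jn.
  by rewrite jk ltnNge leq_addl.
by rewrite leq_addl /= addnK eqn_add2r; case: eqP => //= -> ; rewrite IH /= addnK.
Qed.

Lemma occs_down_addn k n l :
  occs (k + n) l = map_snd (addn^~ n) (occs k (down n l)).
Proof.
rewrite occs_down /map_snd -map_comp -[LHS]map_id; apply/eq_in_map => -[b j].
by rewrite mem_filter /= => /andP[/eqP -> _]; rewrite addnK.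
Qed.

Lemma lin_down k n l :
  (occs k (down n l) == [:: (false, k)]) = (occs (k + n) l == [:: (false, k + n)]).
Proof.
apply/eqP/eqP => H; first by rewrite occs_down_addn H.
by rewrite occs_down H /map_snd /= addnK.
Qed.

Lemma mem_occs b k l : ((b, k) \in occs k l) = ((b, k) \in l).
Proof. by rewrite mem_filter /= eqxx. Qed.

Lemma occs_nilP k l : reflect (forall b, (b, k) \notin l) (occs k l == [::]).
Proof.
apply: (iffP eqP) => [H b|H]; first by rewrite -mem_occs H.
case E: (occs k l) => [//|[b j] l'].
have : (b, j) \in occs k l by rewrite E mem_head.
by rewrite mem_filter /= => /andP[/eqP-> ]; rewrite (negbTE (H b)).
Qed.

Lemma occs_shift k n M : k < n -> occs k (cocc (shift n M)) = [::].
Proof.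
move=> kn; apply/eqP/occs_nilP => b; rewrite /shift cocc_ren.
by apply/mapP => -[[c j] _ [_ E]]; move: kn; rewrite E ltnNge leq_addl.
Qed.

(** A bound index is fixed by [upsubst], and the shifted images of the other indices do not contain
    it; so the linearity of bound variables survives substitution. *)
Lemma occs_upsubst k n s M :
  k < n -> occs k (cocc (subst (upsubst n s) M)) = occs k (cocc M).
Proof.
move=> kn; rewrite cocc_subst occs_flatten -map_comp.
elim: (cocc M) => //= -[b j] l ->; rewrite occs_mark.
case: (ltn_addP n j) => [jn|[i ->]].
  by rewrite upsubst_lt //=; case: eqP => //= _; rewrite orbF.
rewrite upsubst_ge occs_shift //=; case: eqP => // ik; move: kn.
by rewrite -ik ltnNge leq_addl.
Qed.

Lemma linear_ren f M : linear_term M -> linear_term (ren f M).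
Proof.
elim/term_Forall_ind: M f => //=.
- by move=> N L IHN IHL f /andP[/IHN-> /IHL->].
- by move=> N IH f /IH.
- move=> p N IH f /and3P[-> Hl /IH->]; rewrite andbT /=; apply/allP => k kp.
  rewrite /lin renE -(eq_subst _ (upsubst_var _ _)) occs_upsubst ?(allP Hl) //.
    by have := allP Hl k kp.
  by move: kp; rewrite mem_iota.
- move=> Ms IH f /andP[sMs lMs]; rewrite size_map sMs /= all_map.
  by elim: IH lMs {sMs} => //= N Ns IH _ IHs /andP[/(IH f)-> /IHs].
Qed.

Lemma linear_subst s M :
  linear_term M -> (forall b x, (b, x) \in cocc M -> linear_term (s x)) ->
  linear_term (subst s M).
Proof.
have up n M' t : (forall b x, (b, x) \in down n (cocc M') -> linear_term (t x)) ->
    (forall b x, (b, x) \in cocc M' -> linear_term (upsubst n t x)).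
  move=> Ht b x; case: (ltn_addP n x) => [xn|[j ->]]; first by rewrite upsubst_lt.
  by rewrite upsubst_ge -mem_down => /Ht; apply: linear_ren.
elim/term_Forall_ind: M s => //=.
- by move=> x s _ H; apply: (H false); rewrite mem_head.
- by move=> M IH s lM H; apply: IH => // b x xM; apply: (H true); apply: (mem_mark1 true xM).
- move=> M N IHM IHN s /andP[lM lN] H; rewrite IHM ?IHN // => b x xM; apply: (H b);
  by rewrite mem_cat xM ?orbT.
- by move=> M IH s lM H; apply: IH => //; apply: up.
- move=> p M IH s /and3P[-> Hl lM] H; rewrite IH ?andbT //=; last exact: up.
  apply/allP => k kp; rewrite /lin occs_upsubst; first by have := allP Hl k kp.
  by move: kp; rewrite mem_iota.
- move=> Ms IH s /andP[sMs lMs] H; rewrite size_map sMs /= all_map.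
  elim: IH lMs {sMs} H => //= N Ns IH _ IHs /andP[lN lNs] H.
  rewrite IH ?IHs // => b x xM; apply: (H b); rewrite mem_cat xM ?orbT //.
Qed.

Lemma linear_inst Ns M :
  linear_term M -> all linear_term Ns -> linear_term (inst Ns M).
Proof.
move=> lM lNs; apply: linear_subst => // _ x _.
case: (ltnP x (size Ns)) => xN; last by rewrite nth_default.
by apply: all_nthP xN.
Qed.

Lemma cocc_inst Ns M :
  perm_eq (cocc (inst Ns M))
    (down (size Ns) (cocc M) ++
     flatten [seq mark p.1 (cocc (nth (var 0) Ns p.2)) | p <- cocc M & p.2 < size Ns]).
Proof.
rewrite /inst cocc_subst; elim: (cocc M) => //= -[b k] l IH; rewrite down_cons /=.
case: (ltnP k (size Ns)) => kN; last first.
  by rewrite nth_default //= orbF perm_cons.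
rewrite /= perm_sym perm_catCA (set_nth_default (var (k - size Ns))) // perm_cat2l.
by rewrite perm_sym.
Qed.

Lemma qocc_inst Ns M :
  perm_eq (qocc (inst Ns M))
    (qocc M ++
     flatten [seq mark p.1 (qocc (nth (var 0) Ns p.2)) | p <- cocc M & p.2 < size Ns]).
Proof.
rewrite /inst; apply: (perm_trans (qocc_subst _ _)); rewrite perm_cat2l.
elim: (cocc M) => //= -[b k] l IH /=.
case: (ltnP k (size Ns)) => kN; last by rewrite nth_default.
by rewrite /= (set_nth_default (var (k - size Ns))) // perm_cat2l.
Qed.

Lemma filter_lt1 l : [seq p <- l | p.2 < 1] = occs 0 l.
Proof. by apply: eq_filter => -[b k] /=; rewrite ltnS leqn0. Qed.

Lemma perm_filter_lt n (l : seq (bool * nat)) :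
  (forall k, k < n -> occs k l = [:: (false, k)]) ->
  perm_eq [seq p <- l | p.2 < n] [seq (false, k) | k <- iota 0 n].
Proof.
elim: n => [|n IH] H; first by rewrite filter_pred0.
rewrite -addn1 iotaD map_cat /= add0n -(H n) //.
apply: perm_trans (perm_cat (IH _) (perm_refl _)); last by move=> k kn; apply: H; rewrite ltnW.
rewrite addn1 perm_sym.
have := perm_filterC (fun p => p.2 < n) [seq p <- l | p.2 < n.+1].
rewrite -!filter_predI.
have -> : filter (predI (fun p => p.2 < n) (fun p => p.2 < n.+1)) l = [seq p <- l | p.2 < n].
  by apply: eq_filter => -[b k] /=; apply: andb_idr => /ltnW.
have -> : filter (predI (predC (fun p => p.2 < n)) (fun p => p.2 < n.+1)) l = occs n l.
  by apply: eq_filter => -[b k] /=; rewrite -leqNgt ltnS andbC -eqn_leq.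
by move=> E; apply/permPl.
Qed.

(** * Reduction of terms *)

Inductive effect := NoEffect | Apply of nat & seq nat | Create of nat & bool.

Local Arguments subseq : simpl never.

Section TermReduction.
Variable nq : nat -> nat.

(* The action of a reduction step on terms; its action on quantum registers is
   recorded as an effect. *)
Inductive tred : label -> effect -> term -> term -> Prop :=
| tred_Uq i rs : size rs = nq i ->
    tred Uq (Apply i rs) (app (gate i) (tup (map qvar rs))) (tup (map qvar rs))
| tred_new r c : tred New (Create r c) (new (bit c)) (qvar r)
| tred_Lbeta M N : tred Lbeta NoEffect (app (lam PVar M) N) (inst [:: N] M)
| tred_Qbeta n M (rs : seq nat) : n = size rs ->
    tred Qbeta NoEffect (app (lam (PTup n) M) (tup (map qvar rs)))
      (inst (map qvar rs) M)
| tred_Cbeta M N : tred Cbeta NoEffect (app (lamb M) (bang N)) (inst [:: N] M)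
| tred_Lcm L p M N : tred Lcm NoEffect
    (app L (app (lam p M) N)) (app (lam p (app (shift (arity p) L) M)) N)
| tred_Rcm L p M N : tred Rcm NoEffect
    (app (app (lam p M) N) L) (app (lam p (app M (shift (arity p) L))) N)
| tred_tup a e M M' (Ms1 Ms2 : seq term) :
    tred a e M M' -> tred a e (tup (Ms1 ++ M :: Ms2)) (tup (Ms1 ++ M' :: Ms2))
| tred_appl a e M M' N : tred a e M M' -> tred a e (app M N) (app M' N)
| tred_appr a e M N N' : tred a e N N' -> tred a e (app M N) (app M N')
| tred_in_new a e M M' : tred a e M M' -> tred a e (new M) (new M')
| tred_in_lamb a e M M' : tred a e M M' -> tred a e (lamb M) (lamb M')
| tred_in_lam a e p M M' : tred a e M M' -> tred a e (lam p M) (lam p M').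

Definition created (e : effect) : seq (bool * nat) :=
  if e is Create r _ then [:: (false, r)] else [::].

(** An occurrence inside [bang N] carries the flag [true], hence is not the one admissible
    occurrence [(false, k)]: Cbeta cannot duplicate or erase a linear variable. *)
Lemma occs_Cbeta k M N :
  subseq (occs k (cocc (app (lamb M) (bang N)))) [:: (false, k)] ->
  occs k (cocc (bang N)) = [::].
Proof.
rewrite /= occs_cat => H; have {H} := subseq_trans (suffix_subseq _ _) H.
by rewrite occs_mark; case: (occs k (cocc N)) => //= -[b j] l; rewrite xpair_eqE.
Qed.

(* Occurrences of a variable are tracked only as long as it is linear, because
   Cbeta may duplicate the others. *)
Lemma occs_tred a e M M' k :
  tred a e M M' -> linear_term M ->
  subseq (occs k (cocc M)) [:: (false, k)] -> occs k (cocc M') = occs k (cocc M).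
Proof.
have small j (l l' : seq (bool * nat)) :
    subseq l [:: (false, j)] -> perm_eq l' l -> l' = l.
  by move=> /size_subseq sl; apply: perm_small_eq.
move=> H; elim: H k => {a e M M'}.
- move=> i rs _ k _ _ /=.
  by rewrite (_ : map _ _ = [seq [::] | r <- rs]) //= -map_comp.
- by [].
- move=> M N k /andP[/and3P[_ /andP[/eqP l0 _] _] _] H; apply: (small k) => //=.
  apply: (perm_trans (perm_filter _ (cocc_inst _ _))).
  by rewrite -/(occs k _) filter_lt1 l0 /= cats0 mark0.
- move=> n M rs -> k _ H; apply: (small k) => //.
  apply: (perm_trans (perm_filter _ (cocc_inst _ _))).
  rewrite -/(occs k _) size_map !occs_cat perm_cat2l.
  have E : flatten (map cocc (map qvar rs)) = [::] by elim: (rs).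
  rewrite /= E /=; elim: (cocc M) => //= -[b j] l /=.
  case: ltnP => //= jrs IH.
  by rewrite (nth_map 0).
- move=> M N k _ H; apply: (small k) => //.
  apply: (perm_trans (perm_filter _ (cocc_inst _ _))).
  rewrite -/(occs k _) !occs_cat perm_cat2l (occs_Cbeta H) filter_lt1.
  have /eqP := occs_Cbeta H; rewrite occs_flatten occs_mark => kN.
  have {kN} kN : occs k (cocc N) = [::] by move: kN; case: (occs k (cocc N)).
  rewrite -map_comp.
  elim: (cocc M) => //= -[b j] l IH; rewrite /occs /=; case: eqP => //= ->.
  by rewrite -!/(occs _ _) occs_mark kN.
- move=> L p M N k _ _ /=.
  by rewrite down_cat down_shift catA.
- move=> L p M N k _ H; apply: (small k) => //=.
  rewrite down_cat down_shift; apply: perm_filter.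
  by rewrite -!catA perm_cat2l perm_catC.
- move=> a e M M' Ms1 Ms2 _ IH k /= /andP[_ lMs]; move: lMs.
  rewrite all_cat /= => /and3P[_ lM _]; rewrite !map_cat /= !flatten_cat /= !occs_cat => H.
  rewrite IH //; apply: subseq_trans H.
  by apply: subseq_trans (suffix_subseq _ _); apply: prefix_subseq.
- move=> a e M M' N _ IH k /= /andP[lM _]; rewrite !occs_cat => H.
  by rewrite IH //; apply: subseq_trans H; apply: prefix_subseq.
- move=> a e M N N' _ IH k /= /andP[_ lM]; rewrite !occs_cat => H.
  by rewrite IH //; apply: subseq_trans H; apply: suffix_subseq.
- by [].
- move=> a e M M' _ IH k /= lM H; rewrite !occs_down IH //.
  rewrite occs_down_addn; move: H => /(map_subseq (fun p => (p.1, p.2 + 1))).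
  by [].
- move=> a e p M M' _ IH k /= /and3P[_ _ lM] H; rewrite !occs_down IH //.
  rewrite occs_down_addn; move: H => /(map_subseq (fun q => (q.1, q.2 + arity p))).
  by [].
Qed.

Lemma linear_tred a e M M' : tred a e M M' -> linear_term M -> linear_term M'.
Proof.
elim=> {a e M M'} //=.
- by move=> M N /andP[/andP[_ lM] lN]; rewrite linear_inst //= lN.
- move=> n M rs _ /andP[/and3P[_ _ lM] _]; rewrite linear_inst //.
  by rewrite all_map; elim: (rs).
- by move=> M N /andP[lM lN]; rewrite linear_inst //= lN.
- move=> L p M N /andP[lL /andP[/and3P[-> Hl ->] ->]].
  rewrite linear_ren // !andbT /=; apply/allP => k kp; move: (allP Hl k kp).
  by rewrite /lin /= occs_cat occs_shift //; move: kp; rewrite mem_iota.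
- move=> L p M N /andP[/andP[/and3P[-> Hl ->] ->]] lL.
  rewrite linear_ren // !andbT /=; apply/allP => k kp; move: (allP Hl k kp).
  by rewrite /lin /= occs_cat occs_shift ?cats0 //; move: kp; rewrite mem_iota.
- move=> a e M M' Ms1 Ms2 _ IH; rewrite !size_cat /= => /andP[->].
  by rewrite !all_cat /= => /and3P[-> /IH-> ->].
- by move=> a e M M' N _ IH /andP[/IH-> ->].
- by move=> a e M M' N _ IH /andP[-> /IH->].
- move=> a e p M M' H IH /and3P[-> Hl lM]; rewrite IH // andbT /=.
  apply/allP => k kp; move: (allP Hl k kp); rewrite /lin => /eqP E.
  by rewrite (occs_tred H) // E.
Qed.

(** Quantum variables are neither lost nor copied: a pattern variable occurs exactly once, and since
    no quantum variable lies under a [bang], the argument of a Cbeta redex contains none. Only New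
    adds one. *)
Lemma qocc_tred a e M M' :
  tred a e M M' -> linear_term M -> all (fun p => ~~ p.1) (qocc M) ->
  perm_eq (qocc M') (created e ++ qocc M).
Proof.
elim=> {a e M M'} //=.
- move=> M N /andP[/andP[/andP[/eqP l0 _] _] _] _.
  apply: (perm_trans (qocc_inst _ _)).
  by rewrite filter_lt1 l0 /= cats0 mark0.
- move=> n M rs -> /andP[/and3P[_ /allP Hl _] _] _.
  apply: (perm_trans (qocc_inst _ _)); rewrite size_map perm_cat2l.
  (* The occurrences of pattern variables are, up to order, [0, ..., size rs - 1] once each, so
     substitution inserts exactly the list [rs]. *)
  apply: perm_trans (perm_flatten (perm_map _ (perm_filter_lt (n := size rs) _))) _.
    by move=> k kn; apply/eqP/Hl; rewrite mem_iota.
  rewrite -!map_comp; set l1 := map _ _; set l2 := map _ _.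
  suff -> : l1 = l2 by [].
  apply: (@eq_from_nth _ [::]); rewrite !size_map size_iota // => k kn.
  by rewrite (nth_map 0) ?size_iota // (nth_map 0) //= (nth_map 0) nth_iota.
- move=> M N _; rewrite all_cat => /andP[_ uN].
  have qN : qocc N = [::] by case: (qocc N) uN.
  apply: (perm_trans (qocc_inst _ _)); rewrite qN perm_cat2l.
  rewrite filter_lt1; elim: (cocc M) => //= -[b k] l; rewrite /occs /=.
  by case: eqP => //= ->; rewrite qN.
- by move=> L p M N _ _; rewrite qocc_ren catA.
- by move=> L p M N _ _; rewrite qocc_ren -!catA perm_cat2l perm_catC.
- move=> a e M M' Ms1 Ms2 _ IH /andP[_]; rewrite !map_cat !flatten_cat /= !all_cat /=.
  move=> /and3P[_ lM _] /and3P[_ uM _]; rewrite perm_sym perm_catCA perm_cat2l.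
  by rewrite catA perm_cat2r perm_sym IH.
- move=> a e M M' N _ IH /andP[lM _]; rewrite all_cat => /andP[uM _].
  by rewrite catA perm_cat2r IH.
- move=> a e M M' N _ IH /andP[_ lM]; rewrite all_cat => /andP[_ uM].
  by rewrite perm_sym perm_catCA perm_cat2l perm_sym IH.
- by move=> a e p M M' _ IH /and3P[_ _ lM]; apply: IH.
Qed.

Lemma good_tred a e M M' :
  tred a e M M' -> good M -> uniq (unzip2 (created e) ++ qvars M) -> good M'.
Proof.
move=> H /and3P[lM uM _]; have pq := qocc_tred H lM uM; rewrite /good (linear_tred H lM) /=.
rewrite !qvarsE -map_cat => uq; apply/andP; split.
  by rewrite (perm_all _ pq) all_cat uM andbT; case: (e).
by rewrite (perm_uniq (perm_map _ pq)).
Qed.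

Lemma qvars_tred a e M M' :
  tred a e M M' -> good M -> perm_eq (qvars M') (unzip2 (created e) ++ qvars M).
Proof.
move=> H /and3P[lM uM _]; rewrite !qvarsE -map_cat; exact: perm_map (qocc_tred H lM uM).
Qed.

End TermReduction.

(** * Postponement of quantum steps *)

(* The order in which a CNQ computation fires its redexes. *)
Definition rank (a : label) : nat :=
  match a with New => 1 | Uq | Qbeta => 2 | _ => 0 end.

Definition is_name (M : term) : bool :=
  match M with var _ | qvar _ => true | _ => false end.

Lemma map_subst_qvar s rs : map (subst s) (map qvar rs) = map qvar rs.
Proof. by rewrite -map_comp. Qed.

Section Unsubst.
Variable s : nat -> term.
Hypothesis names : forall k, is_name (s k).

Lemma subst_app_inv M A B : subst s M = app A B ->
  exists A' B', [/\ M = app A' B', A = subst s A' & B = subst s B'].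
Proof.
case: M => //= [x E|M N [<- <-]]; last by exists M, N.
by have := names x; rewrite E.
Qed.

Lemma subst_lam_inv M p A : subst s M = lam p A ->
  exists2 A', M = lam p A' & A = subst (upsubst (arity p) s) A'.
Proof.
case: M => //= [x E|q M [<- <-]]; last by exists M.
by have := names x; rewrite E.
Qed.

Lemma subst_lamb_inv M A : subst s M = lamb A ->
  exists2 A', M = lamb A' & A = subst (upsubst 1 s) A'.
Proof.
case: M => //= [x E|M [<-]]; last by exists M.
by have := names x; rewrite E.
Qed.

Lemma subst_bang_inv M A : subst s M = bang A ->
  exists2 A', M = bang A' & A = subst s A'.
Proof.
case: M => //= [x E|M [<-]]; last by exists M.
by have := names x; rewrite E.
Qed.

Lemma subst_new_inv M A : subst s M = new A ->
  exists2 A', M = new A' & A = subst s A'.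
Proof.
case: M => //= [x E|M [<-]]; last by exists M.
by have := names x; rewrite E.
Qed.

Lemma subst_bit_inv M b : subst s M = bit b -> M = bit b.
Proof. by case: M => //= x E; have := names x; rewrite E. Qed.

Lemma subst_tup_inv M Ms1 A Ms2 : subst s M = tup (Ms1 ++ A :: Ms2) ->
  exists Ns1 A' Ns2, [/\ M = tup (Ns1 ++ A' :: Ns2), Ms1 = map (subst s) Ns1,
    A = subst s A' & Ms2 = map (subst s) Ns2].
Proof.
case: M => //= [x E|Ms [E]]; first by have := names x; rewrite E.
have sz : size Ms1 < size Ms.
  by have := congr1 size E; rewrite size_map size_cat /= => ->; rewrite addnS ltnS leq_addr.
exists (take (size Ms1) Ms), (nth (bit false) Ms (size Ms1)), (drop (size Ms1).+1 Ms).
split; first by rewrite -drop_nth // cat_take_drop.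
- by rewrite map_take E take_size_cat.
- by rewrite -(nth_map _ (subst s (bit false))) // E nth_cat ltnn subnn.
- by rewrite map_drop E drop_cat ltnNge leqnSn /= subSnn /= drop0.
Qed.

End Unsubst.

Lemma upsubst_names n s : (forall k, is_name (s k)) -> forall k, is_name (upsubst n s k).
Proof.
move=> names k; case: (ltn_addP n k) => [kn|[j ->]]; first by rewrite upsubst_lt.
by rewrite upsubst_ge; case: (s j) (names j).
Qed.

Section Swap.
Variable nq : nat -> nat.
Local Notation tred := (tred nq).

Lemma tred_subst s a e M M' : tred a e M M' -> tred a e (subst s M) (subst s M').
Proof.
move=> H; elim: H s => {a e M M'} /=.
- by move=> i rs sz s; rewrite map_subst_qvar; constructor.
- by constructor.
- by move=> M N s; rewrite subst_inst; constructor.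
- move=> n M rs -> s; rewrite subst_inst map_subst_qvar size_map; exact: tred_Qbeta.
- by move=> M N s; rewrite subst_inst; constructor.
- by move=> L p M N s; rewrite subst_shift; constructor.
- by move=> L p M N s; rewrite subst_shift; constructor.
- by move=> a e M M' Ms1 Ms2 _ IH s; rewrite !map_cat /=; constructor.
- by constructor.
- by constructor.
- by constructor.
- by constructor.
- by constructor.
Qed.

Lemma tred_shift n a e M M' : tred a e M M' -> tred a e (shift n M) (shift n M').
Proof. by rewrite /shift !renE; apply: tred_subst. Qed.

(* Substituting names creates no redex, except those of gates and of tuple
   patterns. *)
Lemma tred_unsubst s a e M T :
  (forall k, is_name (s k)) -> rank a < 2 -> tred a e (subst s M) T ->
  exists2 M', tred a e M M' & T = subst s M'.
Proof.
move=> names ra; move E: (subst s M) => X H.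
elim: H s M names E ra => {a e X T} //.
- by move=> r c s M names /(subst_new_inv names)[A -> /esym/(subst_bit_inv names) ->] _;
    exists (qvar r) => //; constructor.
- move=> M N s M' names /(subst_app_inv names)[A [B [-> /esym EA ->]]] _.
  case/(subst_lam_inv names): EA => A' -> ->; exists (inst [:: B] A'); first by constructor.
  by rewrite subst_inst.
- move=> M N s M' names /(subst_app_inv names)[A [B [-> /esym EA /esym EB]]] _.
  case/(subst_lamb_inv names): EA => A' -> ->.
  case/(subst_bang_inv names): EB => B' -> ->.
  exists (inst [:: B'] A'); first by constructor.
  by rewrite subst_inst.
- move=> L p M N s M' names /(subst_app_inv names)[A [B [-> -> /esym EB]]] _.
  case/(subst_app_inv names): EB => [B1 [B2 [-> /esym EB1 ->]]].
  case/(subst_lam_inv names): EB1 => A' -> ->.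
  exists (app (lam p (app (shift (arity p) A) A')) B2); first by constructor.
  by rewrite /= subst_shift.
- move=> L p M N s M' names /(subst_app_inv names)[A [B [-> /esym EB ->]]] _.
  case/(subst_app_inv names): EB => [B1 [B2 [-> /esym EB1 ->]]].
  case/(subst_lam_inv names): EB1 => A' -> ->.
  exists (app (lam p (app A' (shift (arity p) B))) B2); first by constructor.
  by rewrite /= subst_shift.
- move=> a e M M' Ms1 Ms2 _ IH s N names E ra.
  have [Ns1 [A [Ns2 [-> -> /esym EA ->]]]] := subst_tup_inv names E.
  have [A' HA ->] := IH s A names EA ra.
  exists (tup (Ns1 ++ A' :: Ns2)); first by constructor.
  by rewrite /= map_cat.
- move=> a e M M' N _ IH s L names /(subst_app_inv names)[A [B [-> /esym EA ->]]] ra.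
  have [A' HA ->] := IH s A names EA ra.
  by exists (app A' B) => //; constructor.
- move=> a e M N N' _ IH s L names /(subst_app_inv names)[A [B [-> -> /esym EB]]] ra.
  have [B' HB ->] := IH s B names EB ra.
  by exists (app A B') => //; constructor.
- move=> a e M M' _ IH s L names /(subst_new_inv names)[A -> /esym EA] ra.
  have [A' HA ->] := IH s A names EA ra.
  by exists (new A') => //; constructor.
- move=> a e M M' _ IH s L names /(subst_lamb_inv names)[A -> /esym EA] ra.
  have [A' HA ->] := IH _ A (upsubst_names 1 names) EA ra.
  by exists (lamb A') => //; constructor.
- move=> a e p M M' _ IH s L names /(subst_lam_inv names)[A -> /esym EA] ra.
  have [A' HA ->] := IH _ A (upsubst_names _ names) EA ra.
  by exists (lam p A') => //; constructor.
Qed.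

Lemma occs_neq k b x l : occs k l = [::] -> (b, x) \in l -> x <> k.
Proof.
by move=> /eqP/occs_nilP H; move=> + E; rewrite E; apply/negP/H.
Qed.

Lemma cat_eq1 (T : Type) (l1 l2 : seq T) x : l1 ++ l2 = [:: x] ->
  (l1 = [:: x] /\ l2 = [::]) \/ (l1 = [::] /\ l2 = [:: x]).
Proof. by case: l1 => [|y [|z l1]] //=; [right | case: l2 => //= -[->]; left]. Qed.

(** As [k] occurs once and outside every [bang], exactly one copy of [s k] appears in [subst s M],
    at a place where reduction is allowed. Two substitutions that agree off [k] are compared because
    this form passes under binders. *)
Lemma tred_subst_lin a e k s t M :
  occs k (cocc M) = [:: (false, k)] -> (forall j, j <> k -> s j = t j) ->
  tred a e (s k) (t k) -> tred a e (subst s M) (subst t M).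
Proof.
have frame u v N j : occs j (cocc N) = [::] -> (forall i, i <> j -> u i = v i) ->
    subst u N = subst v N.
  by move=> oN uv; apply: eq_in_subst => b x /(occs_neq oN)/uv.
have up n u v i : (forall j, j <> i -> u j = v j) ->
    forall j, j <> i + n -> upsubst n u j = upsubst n v j.
  move=> uv j; case: (ltn_addP n j) => [jn|[j' ->]]; first by rewrite !upsubst_lt.
  by move=> H; rewrite !upsubst_ge uv // => E; apply: H; rewrite E.
elim/term_Forall_ind: M k s t => //=.
- by move=> x k s t; rewrite /occs /=; case: eqP => //= ->.
- by move=> M IH k s t; rewrite occs_mark; case: (occs k (cocc M)) => //= -[b j] l [].
- by move=> M IH k s t oM st H; constructor; apply: IH oM _ _.
- move=> M N IHM IHN k s t; rewrite occs_cat => oMN st H; case: (cat_eq1 oMN) => [[oM oN]|[oM oN]].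
    by rewrite (frame s t N k) //; constructor; apply: IHM oM _ _.
  by rewrite (frame s t M k) //; constructor; apply: IHN oN _ _.
- move=> M IH k s t /eqP; rewrite lin_down => /eqP oM st H; constructor.
  by apply: IH oM _ _; [exact: up | rewrite !upsubst_ge; apply: tred_shift].
- move=> p M IH k s t /eqP; rewrite lin_down => /eqP oM st H; constructor.
  by apply: IH oM _ _; [exact: up | rewrite !upsubst_ge; apply: tred_shift].
- move=> Ms IH k s t oMs st H.
  (* [Ns] accumulates the components already passed, since a step in a tuple refers to the whole
     tuple. *)
  suff: forall Ns, tred a e (tup (Ns ++ map (subst s) Ms)) (tup (Ns ++ map (subst t) Ms)).
    by move/(_ [::]).
  elim: IH oMs => //= M Ms' IHM _ IHMs; rewrite occs_cat => oMMs Ns; case: (cat_eq1 oMMs) => [[oM oMs]|[oM oMs]].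
    have [->] : tup (map (subst s) Ms') = tup (map (subst t) Ms').
      exact: (frame s t (tup Ms') k).
    by constructor; apply: IHM oM _ _.
  by rewrite (frame s t M k) // -!cat_rcons; apply: IHMs.
Qed.

(** A chain rather than one step: moving a classical step forward may require commuting conversions
    before it. *)
Inductive cstar : term -> term -> Prop :=
| cstar_refl M : cstar M M
| cstar_step a M N L : rank a = 0 -> tred a NoEffect M N -> cstar N L -> cstar M L.

Lemma cstar1 a M N : rank a = 0 -> tred a NoEffect M N -> cstar M N.
Proof. by move=> ra H; apply: cstar_step ra H (cstar_refl N). Qed.

Lemma cstar_trans M N L : cstar M N -> cstar N L -> cstar M L.
Proof. by elim=> // {}M {}N a K ra H _ IH /IH; apply: cstar_step ra H. Qed.

Lemma cstar_ctx (F : term -> term) :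
  (forall a e M N, tred a e M N -> tred a e (F M) (F N)) ->
  forall M N, cstar M N -> cstar (F M) (F N).
Proof.
move=> HF M N; elim=> [{}M|a {}M {}N L ra H _ IH]; first exact: cstar_refl.
exact: cstar_step ra (HF _ _ _ _ H) IH.
Qed.

(* A commuting conversion brings a context of a tuple redex into the body of
   its pattern abstraction; thus every redex that contracting the tuple redex
   creates in the context can be fired before it. *)
Definition headQ (M M1 : term) : Prop :=
  exists P rs, cstar M (app (lam (PTup (size rs)) P) (tup (map qvar rs))) /\
    M1 = inst (map qvar rs) P.

(** Rcm carries [N] into the body of the pattern abstraction, and instantiating the pattern undoes
    the shift of [N]. *)
Lemma headQ_appl L L1 N : headQ L L1 -> headQ (app L N) (app L1 N).
Proof.
move=> [P [rs [H ->]]]; exists (app P (shift (size rs) N)), rs; split.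
  have HF a e K K' : tred a e K K' -> tred a e (app K N) (app K' N) by exact: tred_appl.
  apply: cstar_trans (cstar_ctx HF H) _.
  by apply: (@cstar1 Rcm) => //; apply: (tred_Rcm _ N (PTup (size rs))).
by rewrite -[in LHS](inst_shift (n := size rs) (Ns := map qvar rs) N) ?size_map.
Qed.

Lemma headQ_appr L N N1 : headQ N N1 -> headQ (app L N) (app L N1).
Proof.
move=> [P [rs [H ->]]]; exists (app (shift (size rs) L) P), rs; split.
  have HF a e K K' : tred a e K K' -> tred a e (app L K) (app L K') by exact: tred_appr.
  apply: cstar_trans (cstar_ctx HF H) _.
  by apply: (@cstar1 Lcm) => //; apply: (tred_Lcm _ L (PTup (size rs))).
by rewrite -[in LHS](inst_shift (n := size rs) (Ns := map qvar rs) L) ?size_map.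
Qed.

Lemma inst_names rs k : is_name (nth (var (k - size (map qvar rs))) (map qvar rs) k).
Proof.
case: (ltnP k (size rs)) => krs; first by rewrite (nth_map 0).
by rewrite nth_default ?size_map.
Qed.

(** The pattern variables are replaced by quantum variables, which are names; so by [tred_unsubst] a
    classical redex of the reduct is already present in the body [P], where it can be fired
    first. *)
Lemma headQ_swap M M1 b M2 : headQ M M1 -> rank b = 0 -> tred b NoEffect M1 M2 ->
  exists2 M3, cstar M M3 & tred Qbeta NoEffect M3 M2.
Proof.
move=> [P [rs [H ->]]] rb.
have rb2 : rank b < 2 by rewrite rb.
move=> /(tred_unsubst (inst_names rs) rb2)[P' HP ->]; exists (app (lam (PTup (size rs)) P') (tup (map qvar rs))).
  apply: cstar_trans H (cstar1 rb _).
  by do 2!constructor.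
exact: tred_Qbeta.
Qed.

Lemma headQ_root n P rs : n = size rs ->
  headQ (app (lam (PTup n) P) (tup (map qvar rs))) (inst (map qvar rs) P).
Proof. by move=> ->; exists P, rs; split=> //; exact: cstar_refl. Qed.

(** * Inversion of steps by the shape of their reduct or of their source *)

Lemma tred_lam_inv a e L p P1 : tred a e L (lam p P1) -> 0 < rank a ->
  (exists2 P, L = lam p P & tred a e P P1) \/
  [/\ a = Qbeta, e = NoEffect & headQ L (lam p P1)].
Proof.
move E: (lam p P1) => X H; case: H E => //=.
- by move=> n M rs en E; right; split=> //; apply: headQ_root.
- by move=> {}a {}e q M M' H [-> ->]; left; exists M.
Qed.

Lemma tred_lamb_inv a e L P1 : tred a e L (lamb P1) -> 0 < rank a ->
  (exists2 P, L = lamb P & tred a e P P1) \/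
  [/\ a = Qbeta, e = NoEffect & headQ L (lamb P1)].
Proof.
move E: (lamb P1) => X H; case: H E => //=.
- by move=> n M rs en E; right; split=> //; apply: headQ_root.
- by move=> {}a {}e M M' H [->]; left; exists M.
Qed.

(** No step takes place under [bang], so the step happens at the root; gates and [new] yield other
    shapes. *)
Lemma tred_bang_inv a e L P1 : tred a e L (bang P1) -> 0 < rank a ->
  [/\ a = Qbeta, e = NoEffect & headQ L (bang P1)].
Proof.
move E: (bang P1) => X H; case: H E => //=.
by move=> n M rs en E; split=> //; apply: headQ_root.
Qed.

(** This is the shape matched by both commuting conversions. In the third case the tuple redex is
    either the whole term or its function part, and [headQ_appl] covers the latter. *)
Lemma tred_app_lam_inv a e L p P1 Q1 : tred a e L (app (lam p P1) Q1) -> 0 < rank a ->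
  [\/ exists2 P, L = app (lam p P) Q1 & tred a e P P1,
      exists2 Q, L = app (lam p P1) Q & tred a e Q Q1 |
      [/\ a = Qbeta, e = NoEffect & headQ L (app (lam p P1) Q1)]].
Proof.
move E: (app _ _) => X H; case: H E => //=.
- by move=> n M rs en E; constructor 3; split=> //; apply: headQ_root.
- move=> {}a {}e M M' N H [E <-] ra; move: H; rewrite -E => /tred_lam_inv.
  case/(_ ra) => [[P -> HP]|[-> -> H]]; first by constructor 1; exists P.
  by constructor 3; split=> //; apply: headQ_appl.
- by move=> {}a {}e M N N' H [<- ->] ra; constructor 2; exists N.
Qed.

(** The shapes of [L] and [N] are given by equations, so that in each case the preceding step, which
    produced [L] or [N], can be inverted in turn. *)
Inductive app_step (b : label) (L N : term) : term -> Prop :=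
| as_Lbeta P : b = Lbeta -> L = lam PVar P -> app_step b L N (inst [:: N] P)
| as_Cbeta P N' : b = Cbeta -> L = lamb P -> N = bang N' ->
    app_step b L N (inst [:: N'] P)
| as_Lcm p P N' : b = Lcm -> N = app (lam p P) N' ->
    app_step b L N (app (lam p (app (shift (arity p) L) P)) N')
| as_Rcm p P L' : b = Rcm -> L = app (lam p P) L' ->
    app_step b L N (app (lam p (app P (shift (arity p) N))) L')
| as_appl L' : tred b NoEffect L L' -> app_step b L N (app L' N)
| as_appr N' : tred b NoEffect N N' -> app_step b L N (app L N').

Lemma tred_app_inv b L N M2 :
  tred b NoEffect (app L N) M2 -> rank b = 0 -> app_step b L N M2.
Proof.
move E: (app _ _) => X; move Ee: NoEffect => e H; case: H E Ee => //=.
- by move=> M N' [-> ->] _ _; apply: as_Lbeta.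
- by move=> M N' [-> ->] _ _; apply: as_Cbeta.
- by move=> L' p M N' [-> ->] _ _; apply: as_Lcm.
- by move=> L' p M N' [-> ->] _ _; apply: as_Rcm.
- by move=> a {}e M M' N' H [-> ->] E' _; apply: as_appl; rewrite E'.
- by move=> a {}e M M' N' H [-> ->] E' _; apply: as_appr; rewrite E'.
Qed.

Lemma tred_New_app e L N X : tred New e (app L N) X ->
  (exists2 L', X = app L' N & tred New e L L') \/
  (exists2 N', X = app L N' & tred New e N N').
Proof.
move E: (app L N) => Y; move Ea: New => a H; case: H E Ea => //.
- by move=> {}a {}e M M' K H [-> ->] _; left; exists M'.
- by move=> {}a {}e M K K' H [-> ->] _; right; exists K'.
Qed.

Lemma tred_tup_inv a e Ns X : tred a e (tup Ns) X ->
  exists Ns1 N N' Ns2, [/\ Ns = Ns1 ++ N :: Ns2, tred a e N N' & X = tup (Ns1 ++ N' :: Ns2)].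
Proof.
move E: (tup Ns) => Y H; case: H E => // {}a {}e M M' Ms1 Ms2 H [->].
by exists Ms1, M, M', Ms2.
Qed.

Lemma tred_lam_dest a e p N X : tred a e (lam p N) X ->
  exists2 N', X = lam p N' & tred a e N N'.
Proof.
by move E: (lam p N) => Y H; case: H E => // {}a {}e q M M' H [-> ->]; exists M'.
Qed.

Lemma tred_lamb_dest a e N X : tred a e (lamb N) X ->
  exists2 N', X = lamb N' & tred a e N N'.
Proof.
by move E: (lamb N) => Y H; case: H E => // {}a {}e M M' H [->]; exists M'.
Qed.

Lemma tred_new_dest a e N X : tred a e (new N) X ->
  (exists2 N', X = new N' & tred a e N N') \/
  exists r c, [/\ a = New, e = Create r c, N = bit c & X = qvar r].
Proof.
move E: (new N) => Y H; case: H E => //.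
- by move=> r c [->]; right; exists r, c.
- by move=> {}a {}e M M' H [->]; left; exists M'.
Qed.

Lemma tred_qvars a e rs X : ~ tred a e (tup (map qvar rs)) X.
Proof.
case/tred_tup_inv=> Ns1 [N [N' [Ns2 [E H _]]]].
have : exists r, N = qvar r.
  elim: rs Ns1 E => [|r rs IH] [|N1 Ns1] //= [].
    by move=> <- _; exists r.
  by move=> _ /IH.
by case=> r Er; move: H; rewrite Er; move EY: (qvar r) => Y H; case: H EY.
Qed.

Lemma tred_qvar a e r X : ~ tred a e (qvar r) X.
Proof. by move EY: (qvar r) => Y H; case: H EY. Qed.

(** Compares the positions of two successive steps in a tuple: same component, or one to the left of
    the other. *)
Lemma cat_cons_eq (T : Type) (s1 s2 t1 t2 : seq T) x y :
  s1 ++ x :: s2 = t1 ++ y :: t2 ->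
  [\/ [/\ s1 = t1, x = y & s2 = t2],
      exists u, t1 = s1 ++ x :: u /\ s2 = u ++ y :: t2 |
      exists u, s1 = t1 ++ y :: u /\ t2 = u ++ x :: s2].
Proof.
elim: s1 t1 => [|z s1 IH] [|w t1] //=.
- by case=> -> ->; constructor 1.
- by case=> -> ->; constructor 2; exists t1.
- by case=> -> <-; constructor 3; exists s1.
- case=> -> /IH[[-> -> ->]|[u [-> ->]]|[u [-> ->]]].
  + by constructor 1.
  + by constructor 2; exists u.
  + by constructor 3; exists u.
Qed.

(** Induction on the first step. A classical redex that it creates together with its context is
    handled by [headQ_swap]. Otherwise the classical redex existed before, and the first step
    survives its contraction: by [tred_subst] if it lies in the body, by [tred_subst_lin] if it lies
    in a linear argument, by [tred_shift] if it is moved under a pattern. *)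
Lemma swap_classical a e M M1 b M2 :
  tred a e M M1 -> 0 < rank a -> linear_term M ->
  rank b = 0 -> tred b NoEffect M1 M2 ->
  exists2 M3, cstar M M3 & tred a e M3 M2.
Proof.
move=> H; elim: H b M2 => {a e M M1} //.
- by move=> i rs _ b M2 _ _ _ /tred_qvars.
- by move=> r c b M2 _ _ _ /tred_qvar.
- move=> n P rs en b M2 _ _ rb H; exact: headQ_swap (headQ_root P en) rb H.
- move=> a e M M' Ms1 Ms2 H IH b M2 ra /andP[_]; rewrite all_cat /= => /and3P[_ lM _] rb.
  case/tred_tup_inv=> Ns1 [N [N' [Ns2 [E HN ->]]]].
  case: (cat_cons_eq E) => [[<- EN <-]|[u [-> ->]]|[u [-> ->]]].
  + rewrite -EN in HN; have [M3 H1 H2] := IH _ _ ra lM rb HN.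
    exists (tup (Ms1 ++ M3 :: Ms2)); last exact: tred_tup.
    by apply: (cstar_ctx (F := fun M => tup (Ms1 ++ M :: Ms2))) H1 => *; apply: tred_tup.
  + exists (tup ((Ms1 ++ M :: u) ++ N' :: Ns2)).
      by apply: (cstar1 rb); rewrite -cat_cons catA; apply: tred_tup.
    by rewrite -!catA !cat_cons; apply: tred_tup.
  + exists (tup ((Ns1 ++ N' :: u) ++ M :: Ms2)).
      by apply: (cstar1 rb); rewrite -!catA !cat_cons; apply: tred_tup.
    by rewrite -cat_cons catA; apply: tred_tup.
- move=> a e L L1 N H IH b M2 ra /andP[lL lN] rb /tred_app_inv/(_ rb).
  case=> {M2} [P _ E|P N' _ E EN|p P N' _ EN|p P L' _ E|L' HL|N' HN].
  (* Either the abstraction was there and the first step lies in its body, or it is the reduct of a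
     tuple redex. *)
  + move: H E => /[swap] -> /tred_lam_inv/(_ ra)[[P0 -> HP]|[-> -> HQ]].
      exists (inst [:: N] P0); last exact: tred_subst.
      by apply: (@cstar1 Lbeta) => //; constructor.
    by apply: headQ_swap (headQ_appl N HQ) (erefl : rank Lbeta = 0) _; constructor.
  + move: H E => /[swap] -> /tred_lamb_inv/(_ ra)[[P0 -> HP]|[-> -> HQ]]; rewrite EN.
      exists (inst [:: N'] P0); last exact: tred_subst.
      by apply: (@cstar1 Cbeta) => //; constructor.
    by apply: headQ_swap (headQ_appl _ HQ) (erefl : rank Cbeta = 0) _; constructor.
  + rewrite EN; exists (app (lam p (app (shift (arity p) L) P)) N').
      by apply: (@cstar1 Lcm) => //; constructor.
    by do 3!constructor; apply: tred_shift.
  + move: H E => /[swap] -> /tred_app_lam_inv/(_ ra)[[P0 -> HP]|[Q -> HQ]|[-> -> HQ]].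
    * exists (app (lam p (app P0 (shift (arity p) N))) L').
        by apply: (@cstar1 Rcm) => //; constructor.
      by do 3!constructor.
    * exists (app (lam p (app P (shift (arity p) N))) Q).
        by apply: (@cstar1 Rcm) => //; constructor.
      exact: tred_appr.
    * by apply: headQ_swap (headQ_appl N HQ) (erefl : rank Rcm = 0) _; constructor.
  + have [M3 H1 H2] := IH _ _ ra lL rb HL; exists (app M3 N); last exact: tred_appl.
    by apply: (cstar_ctx (F := fun M => app M N)) H1 => *; apply: tred_appl.
  + exists (app L N'); last exact: tred_appl.
    by apply: (cstar1 rb); apply: tred_appr.
- move=> a e L N N1 H IH b M2 ra /andP[lL lN] rb /tred_app_inv/(_ rb).
  case=> {M2} [P _ E|P N' _ E EN|p P N' _ EN|p P L' _ E|L' HL|N' HN].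
  (* The first step lies in an argument that is about to be substituted; its variable is linear, so
     exactly one copy of the step remains. *)
  + move: lL; rewrite E => /and3P[_ /andP[/eqP l0 _] _].
    exists (inst [:: N] P); first by apply: (@cstar1 Lbeta) => //; constructor.
    by apply: tred_subst_lin l0 _ _ => // -[].
  (* A duplicable argument contains no step, so the [bang] itself was uncovered by a tuple redex. *)
  + move: H; rewrite EN => /tred_bang_inv/(_ ra)[-> -> HQ]; rewrite E.
    by apply: headQ_swap (headQ_appr _ HQ) (erefl : rank Cbeta = 0) _; constructor.
  + move: H EN => /[swap] -> /tred_app_lam_inv/(_ ra)[[P0 -> HP]|[Q -> HQ]|[-> -> HQ]].
    * exists (app (lam p (app (shift (arity p) L) P0)) N').
        by apply: (@cstar1 Lcm) => //; constructor.
      by do 2!constructor; apply: tred_appr.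
    * exists (app (lam p (app (shift (arity p) L) P)) Q).
        by apply: (@cstar1 Lcm) => //; constructor.
      exact: tred_appr.
    * by apply: headQ_swap (headQ_appr L HQ) (erefl : rank Lcm = 0) _; constructor.
  + rewrite E; exists (app (lam p (app P (shift (arity p) N))) L').
      by apply: (@cstar1 Rcm) => //; constructor.
    by do 2!constructor; apply: tred_appr; apply: tred_shift.
  + exists (app L' N); last exact: tred_appr.
    by apply: (cstar1 rb); apply: tred_appl.
  + have [M3 H1 H2] := IH _ _ ra lN rb HN; exists (app L M3); last exact: tred_appr.
    by apply: (cstar_ctx (F := fun M => app L M)) H1 => *; apply: tred_appr.
- move=> a e M M' H IH b M2 ra lM rb /tred_new_dest[[N' -> HN]|[r [c [E]]]]; last first.
    by rewrite E in rb.
  have [M3 H1 H2] := IH _ _ ra lM rb HN; exists (new M3); last exact: tred_in_new.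
  by apply: (cstar_ctx (F := new)) H1 => *; apply: tred_in_new.
- move=> a e M M' H IH b M2 ra lM rb /tred_lamb_dest[N' -> HN].
  have [M3 H1 H2] := IH _ _ ra lM rb HN; exists (lamb M3); last exact: tred_in_lamb.
  by apply: (cstar_ctx (F := lamb)) H1 => *; apply: tred_in_lamb.
- move=> a e p M M' H IH b M2 ra /and3P[_ _ lM] rb /tred_lam_dest[N' -> HN].
  have [M3 H1 H2] := IH _ _ ra lM rb HN; exists (lam p M3); last exact: tred_in_lam.
  by apply: (cstar_ctx (F := lam p)) H1 => *; apply: tred_in_lam.
Qed.

(** The step contracts a tuple redex whose body is the bit itself; then the pattern is empty or one
    of its variables does not occur in the body. *)
Lemma tred_bit a e M c : tred a e M (bit c) -> 1 < rank a -> ~~ linear_term M.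
Proof.
move E: (bit c) => X H; case: H E => //= n P rs _ /esym/(subst_bit_inv (inst_names rs)) -> _.
by case: n => //= n; rewrite /lin /= andbF.
Qed.

(** One step suffices here, because a quantum step creates no [new] redex: the body of a contracted
    tuple redex is covered by [tred_unsubst], the argument of [new] by [tred_bit]. *)
Lemma swap_New a e M M1 e' M2 :
  tred a e M M1 -> 1 < rank a -> linear_term M -> tred New e' M1 M2 ->
  exists2 M3, tred New e' M M3 & tred a e M3 M2.
Proof.
move=> H; elim: H M2 => {a e M M1} //.
- by move=> i rs _ M2 _ _ /tred_qvars.
- move=> n P rs en M2 _ _ /(tred_unsubst (inst_names rs))[] // P' HP ->.
  exists (app (lam (PTup n) P') (tup (map qvar rs))); first by do 2!constructor.
  exact: tred_Qbeta.
- move=> a e M M' Ms1 Ms2 H IH M2 ra /andP[_]; rewrite all_cat /= => /and3P[_ lM _].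
  case/tred_tup_inv=> Ns1 [N [N' [Ns2 [E HN ->]]]].
  case: (cat_cons_eq E) => [[<- EN <-]|[u [-> ->]]|[u [-> ->]]].
  + rewrite -EN in HN; have [M3 H1 H2] := IH _ ra lM HN.
    by exists (tup (Ms1 ++ M3 :: Ms2)); apply: tred_tup.
  + exists (tup ((Ms1 ++ M :: u) ++ N' :: Ns2)).
      by rewrite -cat_cons catA; apply: tred_tup.
    by rewrite -!catA !cat_cons; apply: tred_tup.
  + exists (tup ((Ns1 ++ N' :: u) ++ M :: Ms2)).
      by rewrite -!catA !cat_cons; apply: tred_tup.
    by rewrite -cat_cons catA; apply: tred_tup.
- move=> a e L L1 N H IH M2 ra /andP[lL _] /tred_New_app[[L' -> HL]|[N' -> HN]].
    by have [M3 H1 H2] := IH _ ra lL HL; exists (app M3 N); apply: tred_appl.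
  by exists (app L N'); [apply: tred_appr | apply: tred_appl].
- move=> a e L N N1 H IH M2 ra /andP[_ lN] /tred_New_app[[L' -> HL]|[N' -> HN]].
    by exists (app L' N); [apply: tred_appl | apply: tred_appr].
  by have [M3 H1 H2] := IH _ ra lN HN; exists (app L M3); apply: tred_appr.
- move=> a e M M' H IH M2 ra lM /tred_new_dest[[N' -> HN]|[r [c [_ _ E _]]]].
    have [M3 H1 H2] := IH _ ra lM HN.
    by exists (new M3); apply: tred_in_new.
  by move: H lM; rewrite E => /tred_bit/(_ ra)/negbTE /= ->.
- move=> a e M M' H IH M2 ra lM /tred_lamb_dest[N' -> HN].
  have [M3 H1 H2] := IH _ ra lM HN.
  by exists (lamb M3); apply: tred_in_lamb.
- move=> a e p M M' H IH M2 ra /and3P[_ _ lM] /tred_lam_dest[N' -> HN].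
  have [M3 H1 H2] := IH _ ra lM HN.
  by exists (lam p M3); apply: tred_in_lam.
Qed.

End Swap.

(** * Quantum registers and renamings *)

Section QRen.
Variable th : nat -> nat.

Lemma qren_ren f M : qren th (ren f M) = ren f (qren th M).
Proof.
elim/term_cons_ind: M f => //= [M IH f|M IH f|M N IHM IHN f|M IH f|p M IH f|M Ms IHM IHMs f];
  rewrite ?IH ?IHM ?IHN //.
by case: (IHMs f) => ->.
Qed.

Lemma qren_subst s M : qren th (subst s M) = subst (qren th \o s) (qren th M).
Proof.
have up n t : qren th \o upsubst n t =1 upsubst n (qren th \o t).
  move=> k /=; case: (ltn_addP n k) => [kn|[j ->]]; first by rewrite !upsubst_lt.
  by rewrite !upsubst_ge /shift qren_ren.
elim/term_cons_ind: M s => //= [M IH f|M IH f|M N IHM IHN f|M IH f|p M IH f|M Ms IHM IHMs f];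
  rewrite ?IH ?IHM ?IHN ?(eq_subst _ (up _ _)) //.
by case: (IHMs f) => ->.
Qed.

Lemma qren_inst Ns M : qren th (inst Ns M) = inst (map (qren th) Ns) (qren th M).
Proof.
rewrite /inst qren_subst size_map; apply: eq_subst => k /=.
case: (ltnP k (size Ns)) => kN; first by rewrite !(nth_map (var (k - size Ns))).
by rewrite !nth_default ?size_map.
Qed.

Lemma map_qren_qvar rs : map (qren th) (map qvar rs) = map qvar (map th rs).
Proof. by rewrite -!map_comp. Qed.

Lemma cocc_qren M : cocc (qren th M) = cocc M.
Proof.
by elim/term_cons_ind: M => //= [M ->|M N -> ->|M ->|p M ->|M Ms -> ->].
Qed.

Lemma qocc_qren M : qocc (qren th M) = map_snd th (qocc M).
Proof.
elim/term_cons_ind: M => //= [M ->|M N -> ->|M Ms -> ->].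
- by rewrite /mark /map_snd -!map_comp.
- by rewrite /map_snd map_cat.
- by rewrite /map_snd map_cat.
Qed.

Lemma qvars_qren M : qvars (qren th M) = map th (qvars M).
Proof. by rewrite !qvarsE qocc_qren /unzip2 /map_snd -!map_comp. Qed.

Lemma linear_qren M : linear_term (qren th M) = linear_term M.
Proof.
elim/term_Forall_ind: M => //= [M N -> ->|p M ->|Ms IH] //.
  by congr [&& _, _ & _]; apply: eq_all => k; rewrite /lin cocc_qren.
by rewrite size_map all_map; congr (_ && _); elim: IH => //= M Ms' -> _ ->.
Qed.

Lemma good_qren M : {in qvars M &, injective th} -> good M -> good (qren th M).
Proof.
move=> inj /and3P[lM uM uq]; rewrite /good linear_qren lM qvars_qren map_inj_in_uniq // uq.
by rewrite qocc_qren all_map andbT.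
Qed.

Definition qren_effect (e : effect) : effect :=
  match e with
  | NoEffect => NoEffect
  | Apply i rs => Apply i (map th rs)
  | Create r c => Create (th r) c
  end.

Lemma tred_qren nq a e M M' : tred nq a e M M' ->
  tred nq a (qren_effect e) (qren th M) (qren th M').
Proof.
elim=> {a e M M'} /=.
- by move=> i rs sz; rewrite map_qren_qvar; constructor; rewrite size_map.
- by constructor.
- by move=> M N; rewrite qren_inst; constructor.
- by move=> n M rs en; rewrite qren_inst map_qren_qvar; constructor; rewrite size_map.
- by move=> M N; rewrite qren_inst; constructor.
- by move=> L p M N; rewrite /shift qren_ren; constructor.
- by move=> L p M N; rewrite /shift qren_ren; constructor.
- by move=> a e M M' Ms1 Ms2 _ IH; rewrite !map_cat; constructor.
- by constructor.
- by constructor.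
- by constructor.
- by constructor.
- by constructor.
Qed.

End QRen.

Lemma tred_Apply nq a i rs M M' : tred nq a (Apply i rs) M M' -> {subset rs <= qvars M}.
Proof.
move E: (Apply i rs) => e H; elim: H E => //= {a e M M'}.
- by move=> j rs' _ [_ <-] r; rewrite -map_comp; elim: rs => //= s rs IH; rewrite !inE => /orP[->|/IH->]; rewrite ?orbT.
- move=> a e M M' Ms1 Ms2 _ IH /IH sub r /sub rM.
  by rewrite map_cat flatten_cat /= !mem_cat rM orbT.
- by move=> a e M M' N _ IH /IH sub r /sub rM; rewrite mem_cat rM.
- by move=> a e M N N' _ IH /IH sub r /sub rM; rewrite mem_cat rM orbT.
Qed.

(** Reads the effect off the rank: rank 0 leaves only [NoEffect], and rank 1 only [Create]. *)
Lemma tred_rank nq a e M M' : tred nq a e M M' ->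
  rank a = match e with Create _ _ => 1 | Apply _ _ => 2 | NoEffect => rank a end
  /\ (e = NoEffect -> rank a <> 1).
Proof. by elim. Qed.

Section States.
Local Open Scope ring_scope.
Local Open Scope fset_scope.
Variable R : realType.
Implicit Types (S : qstate R) (V : {fset nat}).

Lemma ext_res V a r : ext (res V a) r = (r \in V) && a r.
Proof. by rewrite /ext; case: insubP => [x -> <-|/negbTE ->] //; rewrite ffunE. Qed.

Lemma res_ext V (f : {ffun V -> bool}) : res V (ext f) = f.
Proof. by apply/ffunP => x; rewrite ffunE /ext valK. Qed.

Lemma eq_res V a b : {in V, a =1 b} -> res V a = res V b.
Proof. by move=> ab; apply/ffunP => x; rewrite !ffunE ab ?fsvalP. Qed.

(** The type of the register depends on [qv], so registers are compared on global assignments rather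
    than across two types. *)
Lemma qstateP S T :
  qv S = qv T -> (forall a, reg S (res (qv S) a) = reg T (res (qv T) a)) -> S = T.
Proof.
case: S T => V f [W g] /= VW; case: W / VW g => g H.
by congr QState; apply/ffunP => h; rewrite -(res_ext h).
Qed.

Lemma reg_apply_op n (A : 'M[R[i]%C]_(2 ^ n)) (t : n.-tuple nat) S a :
  {subset t <= qv S} ->
  reg (apply_op A t S) (res (qv (apply_op A t S)) a) =
  \sum_(b : n.-tuple bool) A (code [tuple of map a t]) (code b) *
    reg S (res (qv S) (update a t b)).
Proof.
move=> tS; rewrite ffunE; apply: eq_bigr => b _.
have -> : [tuple of map (ext (res (qv S) a)) t] = [tuple of map a t].
  by apply: val_inj; apply/eq_in_map => r /tS rS; rewrite ext_res rS.
congr (_ * reg S _); apply: eq_res => r rS; rewrite /update.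
by case: ifP => // _; rewrite ext_res rS.
Qed.

Lemma reg_add_qubit S r c a :
  reg (add_qubit S r c) (res (qv (add_qubit S r c)) a) =
    reg S (res (qv S) a) * (a r == c)%:R.
Proof.
rewrite ffunE ext_res fset1U1; congr (reg S _ * _).
by apply: eq_res => s sS; rewrite ext_res in_fsetU sS orbT.
Qed.

Definition qren_state th S : qstate R :=
  QState [ffun f : {ffun [fset th r | r in qv S] -> bool} => reg S (res (qv S) (ext f \o th))].

Lemma reg_qren_state th S a :
  reg (qren_state th S) (res (qv (qren_state th S)) a) = reg S (res (qv S) (a \o th)).
Proof.
rewrite ffunE; congr (reg S _); apply: eq_res => r rS /=.
by rewrite ext_res in_imfset.
Qed.

Variables (nq : nat -> nat) (U : forall i, 'M[R[i]%C]_(2 ^ nq i)).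

(** The tuple is quantified existentially because the length of [rs] in [Apply i rs] is not part of
    its type. *)
Definition eff (e : effect) (S S1 : qstate R) : Prop :=
  match e with
  | NoEffect => S1 = S
  | Apply i rs => exists2 t : (nq i).-tuple nat, tval t = rs & S1 = apply_op (U i) t S
  | Create r c => r \notin qv S /\ S1 = add_qubit S r c
  end.

(** Separates terms from registers, so that exchanges are proved first for [tred] and then for
    effects. *)
Lemma redP a S M S1 M1 :
  red U a S M S1 M1 <-> exists2 e, tred nq a e M M1 & eff e S S1.
Proof.
split.
  elim=> {a S M S1 M1}; try by [move=> *; match goal with H : exists2 _, _ & _ |- _ => case: H => e; exists e => //; constructor end].
  - move=> S i rs; exists (Apply i rs); last by exists rs.
    by constructor; rewrite size_tuple.
  - by move=> S c r rS; exists (Create r c) => //; constructor.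
  - by move=> S M N; exists NoEffect => //; constructor.
  - by move=> S M rs; exists NoEffect => //; constructor.
  - by move=> S M N; exists NoEffect => //; constructor.
  - by move=> S L p M N; exists NoEffect => //; constructor.
  - by move=> S L p M N; exists NoEffect => //; constructor.
case=> e; elim=> {a e M M1}; try by [move=> *; constructor; auto].
- by move=> i rs _ [t <- ->]; constructor.
- by move=> r c [rS ->]; constructor.
- by move=> M N ->; constructor.
- by move=> n M rs -> ->; constructor.
- by move=> M N ->; constructor.
- by move=> L p M N ->; constructor.
- by move=> L p M N ->; constructor.
Qed.

Lemma eff_qv e S S1 : eff e S S1 -> qv S1 = [fset r | r in unzip2 (created e)] `|` qv S.
Proof.
have E : [fset r | r in Nil nat] `|` qv S = qv S.
  by apply/fsetP => x; rewrite in_fsetU in_fset.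
case: e => [->|i rs [t _ ->]|r c [_ ->]] //=.
by apply/fsetP => x; rewrite !in_fsetU in_fset1 in_fset inE.
Qed.

(** The created qubit is fresh, whereas a gate acts on qubits that were already present; so [update]
    does not touch the factor [a r == c], which can be moved through the sum. *)
Lemma eff_Create_swap e r c S S1 S2 :
  (if e is Apply i rs then {subset rs <= qv S} else e = NoEffect) ->
  eff e S S1 -> eff (Create r c) S1 S2 ->
  exists2 S3, eff (Create r c) S S3 & eff e S3 S2.
Proof.
case: e => [_ -> H|i rs sub [t Et ->] [rS ->]|//]; first by exists S2.
exists (add_qubit S r c) => //; exists t => //; apply: qstateP => // a.
rewrite -Et in sub.
rewrite reg_add_qubit reg_apply_op // reg_apply_op; last first.
  by move=> s /sub sS; rewrite in_fsetU sS orbT.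
rewrite mulr_suml; apply: eq_bigr => b _; rewrite -mulrA; congr (_ * _).
rewrite reg_add_qubit; congr (_ * (_ == c)%:R).
by rewrite /update ifN //; apply: contra rS => /sub.
Qed.

(** Injectivity ensures that a renamed gate updates the images of its own qubits only, and that the
    image of a fresh qubit is fresh. *)
Lemma eff_qren th e S S1 :
  (if e is Apply i rs then {subset rs <= qv S} else True) ->
  {in qv S1 &, injective th} -> eff e S S1 ->
  eff (qren_effect th e) (qren_state th S) (qren_state th S1).
Proof.
case: e => [_ _ -> //|i rs sub inj [t Et E]|r c _ inj [rS E]] /=.
  rewrite -Et in sub *; rewrite E in inj *; exists [tuple of map th t] => //.
  apply: qstateP => // a; rewrite reg_qren_state reg_apply_op // reg_apply_op; last first.
    by move=> r /mapP[s /sub sS ->]; rewrite in_imfset.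
  apply: eq_bigr => b _; congr (U i (code _) _ * _).
    by apply: val_inj; rewrite /= -map_comp.
  rewrite reg_qren_state; congr (reg S _).
  apply: eq_res => r rS; rewrite /update /=.
  have inj_t : {in r :: t &, injective th}.
    by apply: sub_in2 inj => x; rewrite inE => /predU1P[->|/sub].
  have -> : (th r \in map th t) = (r \in t).
    apply/mapP/idP => [[s st E']|rt]; last by exists r.
    by rewrite (inj_t r s) // ?inE ?eqxx ?st ?orbT.
  case: ifP => // rt; congr nth.
  elim: (tval t) inj_t {rt sub Et} => //= s t' IH inj_t.
  rewrite (inj_in_eq inj_t) ?inE ?eqxx ?orbT // IH //.
  by apply: sub_in2 inj_t => z; rewrite !inE => /orP[] ->; rewrite ?orbT.
rewrite E in inj *; split.
  apply: contra rS => /imfsetP[s /= sS] /inj -> //=.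
    by rewrite fset1U1.
  by rewrite in_fsetU sS orbT.
apply: qstateP => [|a].
  apply/fsetP => x /=; rewrite in_fsetU in_fset1; apply/imfsetP/orP => /=.
    case=> s; rewrite in_fsetU in_fset1 => /orP[/eqP -> ->|sS ->]; first by left.
    by right; rewrite in_imfset.
  case=> [/eqP ->|/imfsetP[s /= sS ->]]; first by exists r; rewrite ?fset1U1.
  by exists s => //; rewrite in_fsetU sS orbT.
by rewrite reg_qren_state !reg_add_qubit reg_qren_state.
Qed.

End States.

(** * Well-formedness *)

Definition cv (G : env) := flatten (map entry_cvars G).
Definition qvn (G : env) := flatten (map entry_qvars G).

Definition entry_lin (e : entry) : seq nat :=
  match e with ELin x => [:: x] | EPat xs => xs | _ => [::] end.

Definition lv (G : env) := flatten (map entry_lin G).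

Lemma env_okE G : env_ok G = uniq (cv G) && uniq (qvn G).
Proof. by []. Qed.

Lemma cv_cat G D : cv (G ++ D) = cv G ++ cv D.
Proof. by rewrite /cv map_cat flatten_cat. Qed.

Lemma qvn_cat G D : qvn (G ++ D) = qvn G ++ qvn D.
Proof. by rewrite /qvn map_cat flatten_cat. Qed.

Lemma lv_cat G D : lv (G ++ D) = lv G ++ lv D.
Proof. by rewrite /lv map_cat flatten_cat. Qed.

Lemma perm_cv G D : perm_eq G D -> perm_eq (cv G) (cv D).
Proof. by move=> /(perm_map entry_cvars)/perm_flatten. Qed.

Lemma perm_qvn G D : perm_eq G D -> perm_eq (qvn G) (qvn D).
Proof. by move=> /(perm_map entry_qvars)/perm_flatten. Qed.

Lemma perm_lv G D : perm_eq G D -> perm_eq (lv G) (lv D).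
Proof. by move=> /(perm_map entry_lin)/perm_flatten. Qed.

Lemma perm_env_ok G D : perm_eq G D -> env_ok G = env_ok D.
Proof. by move=> p; rewrite !env_okE (perm_uniq (perm_cv p)) (perm_uniq (perm_qvn p)). Qed.

Lemma cv_ELin xs : cv (map ELin xs) = xs.
Proof. by rewrite /cv -map_comp; elim: xs => //= x xs ->. Qed.

Lemma cv_EBang xs : cv (map EBang xs) = xs.
Proof. by rewrite /cv -map_comp; elim: xs => //= x xs ->. Qed.

Lemma cv_EQ rs : cv (map EQ rs) = [::].
Proof. by elim: rs. Qed.

Lemma qvn_ELin xs : qvn (map ELin xs) = [::].
Proof. by elim: xs. Qed.

Lemma qvn_EBang xs : qvn (map EBang xs) = [::].
Proof. by elim: xs. Qed.

Lemma qvn_EQ rs : qvn (map EQ rs) = rs.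
Proof. by rewrite /qvn -map_comp; elim: rs => //= x xs ->. Qed.

Lemma lv_ELin xs : lv (map ELin xs) = xs.
Proof. by rewrite /lv -map_comp; elim: xs => //= x xs ->. Qed.

Lemma lv_EBang xs : lv (map EBang xs) = [::].
Proof. by elim: xs. Qed.

Lemma cv_shift n G : cv (map (shift_entry n) G) = map (addn^~ n) (cv G).
Proof. by elim: G => //= -[x|x|xs|r] G IH; rewrite /cv /= -/(cv _) IH ?map_cat. Qed.

Lemma qvn_shift n G : qvn (map (shift_entry n) G) = qvn G.
Proof. by elim: G => //= -[x|x|xs|r] G IH; rewrite /qvn /= -/(qvn _) IH. Qed.

Lemma lv_shift n G : lv (map (shift_entry n) G) = map (addn^~ n) (lv G).
Proof. by elim: G => //= -[x|x|xs|r] G IH; rewrite /lv /= -/(lv _) IH ?map_cat. Qed.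

Lemma sub_lv G : {subset lv G <= cv G}.
Proof.
move=> x; rewrite /lv /cv; elim: G => //= e G IH; rewrite !mem_cat => /orP[|/IH->]; last by rewrite orbT.
by case: e => [y|y|ys|r] //= ->.
Qed.

Lemma occs_map_snd f k l :
  (forall b x, (b, x) \in l -> f x = k <-> x = k) -> occs k (map_snd f l) = occs k l.
Proof.
elim: l => //= -[b x] l IH H; rewrite /occs /= -!/(occs _ _) IH; last first.
  by move=> c y yl; apply: (H c); rewrite inE yl orbT.
have [H1 H2] := H b x (mem_head _ _).
by case: (eqVneq x k) => [xk|/eqP xk]; [rewrite (H2 xk) eqxx xk | case: eqP => // /H1].
Qed.

Definition wf_invariant (G : env) (M : term) : Prop :=
  [/\ linear_term M, all (fun p => ~~ p.1) (qocc M), perm_eq (qvars M) (qvn G),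
      {in lv G, forall x, lin x M} &
      forall b x, (b, x) \in cocc M -> x \in cv G].

Lemma occs_notin G M x : (forall b x, (b, x) \in cocc M -> x \in cv G) ->
  x \notin cv G -> occs x (cocc M) = [::].
Proof. by move=> H xG; apply/eqP/occs_nilP => b; apply: contra xG => /H. Qed.

Lemma mem_map_addn n x l : (x + n \in map (addn^~ n) l) = (x \in l).
Proof. exact: (mem_map (@addIn n)). Qed.

Lemma lin_cat G1 G2 M1 M2 : uniq (cv G1 ++ cv G2) ->
  wf_invariant G1 M1 -> (forall b x, (b, x) \in cocc M2 -> x \in cv G2) ->
  {in lv G1, forall x, occs x (cocc M1 ++ cocc M2) == [:: (false, x)]}.
Proof.
rewrite cat_uniq => /and3P[_ /hasPn disj _] [_ _ _ lM1 _] sub2 x xG1.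
rewrite occs_cat (eqP (lM1 x xG1)) (occs_notin sub2) //.
by apply/negP => /disj /negP; apply; apply: sub_lv.
Qed.

(** The bound on the number of components is left out so that the induction on the list goes
    through. An application is treated in [wf_sound] as a tuple of two components. *)
Lemma wf_tup_invariant (GMs : seq (env * term)) :
  uniq (cv (flatten (unzip1 GMs))) ->
  (forall k, k < size GMs ->
     wf_invariant (nth [::] (unzip1 GMs) k) (nth (bit false) (unzip2 GMs) k)) ->
  [/\ all linear_term (unzip2 GMs), all (fun p => ~~ p.1) (qocc (tup (unzip2 GMs))),
      perm_eq (qvars (tup (unzip2 GMs))) (qvn (flatten (unzip1 GMs))),
      {in lv (flatten (unzip1 GMs)), forall x, lin x (tup (unzip2 GMs))} &
      forall b x, (b, x) \in cocc (tup (unzip2 GMs)) -> x \in cv (flatten (unzip1 GMs))].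
Proof.
elim: GMs => //= -[G M] GMs IH; rewrite cv_cat => uG H.
have /= H0 := H 0 isT.
have [|k kG|a b c d e] := IH; [by move: uG; rewrite cat_uniq => /and3P[] | exact: (H k.+1) |].
have [a0 b0 c0 d0 e0] := H0.
split=> /=.
- by rewrite a0.
- by rewrite all_cat b0.
- by rewrite qvn_cat; apply: perm_cat.
- move=> x; rewrite lv_cat mem_cat => /orP[xG|xG].
    exact: (lin_cat (M2 := tup (unzip2 GMs)) uG H0 e).
  rewrite /lin /= occs_cat (occs_notin e0); first exact: (d x).
  move: uG; rewrite cat_uniq => /and3P[_ /hasPn disj _].
  by have := disj x (sub_lv xG).
- by move=> b' x; rewrite !mem_cat => /orP[/e0->|/e->]; rewrite ?orbT.
Qed.

Definition pat_ok (e : entry) : bool := if e is EPat xs then 1 < size xs else true.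

(** [pat_ok] is carried along to supply the pattern size that [linear_term] asks of an
    abstraction. *)
Lemma wf_sound G M : wf G M -> [/\ env_ok G, all pat_ok G & wf_invariant G M].
Proof.
elim=> {G M}.
- move=> G D M p _ [ok pk [a b c d e]]; rewrite -(perm_env_ok p) -(perm_all _ p); split=> //.
  split=> //.
  + by apply: (perm_trans c); apply: perm_qvn.
  + by move=> x; rewrite -(perm_mem (perm_lv p)); apply: d.
  + by move=> b' x /e; rewrite (perm_mem (perm_cv p)).
- by [].
- by [].
- by [].
- move=> x; split=> //; split=> // [y|b y]; rewrite !inE => /eqP.
    by move=> ->; rewrite /lin /occs /= eqxx.
  by case=> _ ->.
- move=> G x M ok _ [_ pk [a b c d e]]; split=> //; split=> // b' y /e.
  by rewrite /cv /= inE => ->; rewrite orbT.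
- move=> G x y z M ok _ [ok' pk [a b c d e]]; split=> //.
  (* The linear variables of [G] differ from [x], [y] and [z], so the contraction leaves their
     occurrences alone. *)
  have dz w : w \in cv G -> w != z.
    by move=> wG; apply: contraTneq wG => ->; move: ok => /andP[/= /andP[]].
  have dxy w : w \in cv G -> w \notin [:: x; y].
    move=> wG; apply: contraTN wG; move: ok' => /andP[/= /and3P[]].
    by rewrite !inE negb_or => /andP[_ xG] yG _ _ /orP[] /eqP->.
  split.
  + exact: linear_ren.
  + by rewrite qocc_ren.
  + by rewrite qvarsE qocc_ren -qvarsE.
  + move=> w; rewrite {1}/lv /= -/(lv G) => wG; have wG' := sub_lv wG.
    rewrite /lin cocc_ren occs_map_snd; first exact: (d w).
    move=> b' v _; case: ifP => vxy; last by [].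
    split=> [E|E]; first by have := dz _ wG'; rewrite E eqxx.
    by have := dxy _ wG'; rewrite -E vxy.
  + move=> b' w; rewrite cocc_ren => /mapP[[b'' v] /= /e vG [_ ->]].
    rewrite /cv /= !inE; case: ifP => [_|vxy]; first by rewrite eqxx.
    by move: vG vxy; rewrite /cv /= !inE orbA => /orP[->|->]; rewrite ?orbT.
- move=> xs M _ [ok pk [a b c d e]]; split=> //; split=> //=.
  (* Duplicable entries declare no quantum variable, so none lies under the [bang]. *)
  + have : qocc M = [::].
      by move/perm_size: c; rewrite qvarsE qvn_EBang size_map; case: (qocc M).
    by move=> ->.
  + by move=> x; rewrite lv_EBang.
  + by move=> b' x /mem_mark[b'' /e].
- move=> G x M _ [ok pk [a b c d e]]; split=> //; split=> // y yG.
  by apply: d; rewrite /lv /= inE yG orbT.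
- move=> G xs M sxs _ [ok pk [a b c d e]].
  have Ec : cv (EPat xs :: G) = cv (map ELin xs ++ G) by rewrite cv_cat cv_ELin.
  have El : lv (EPat xs :: G) = lv (map ELin xs ++ G) by rewrite lv_cat lv_ELin.
  have Eq : qvn (EPat xs :: G) = qvn (map ELin xs ++ G) by rewrite qvn_cat qvn_ELin.
  split; first by rewrite env_okE Ec Eq.
    by rewrite /= sxs; move: pk; rewrite all_cat => /andP[].
  by split; rewrite ?Ec ?El ?Eq.
- move=> GMs sz ok _ IH.
  have [|k kG|a b c d e] := wf_tup_invariant (GMs := GMs).
  + by case/andP: ok.
  + by have [] := IH k kG.
  split=> //; last by split=> //=; rewrite size_map sz.
  have {}IH k : k < size GMs -> all pat_ok (nth [::] (unzip1 GMs) k) by move=> /IH[].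
  elim: (GMs) IH => //= -[G M] GMs' IHs IH; rewrite all_cat (IH 0) //.
  by apply: IHs => k; apply: (IH k.+1).
- by move=> G M _ [].
- move=> G p M _ [ok pk [a b c d e]].
  have Ecp : cv [:: pat_entry p] = iota 0 (arity p) by case: (p) => //= n; rewrite /cv /= cats0.
  have Elp : lv [:: pat_entry p] = iota 0 (arity p) by case: (p) => //= n; rewrite /lv /= cats0.
  have Eqp : qvn [:: pat_entry p] = [::] by case: (p).
  rewrite -cat1s in ok c d e.
  have uG : uniq (cv G).
    move: ok => /andP[]; rewrite -/(cv _) cv_cat cat_uniq cv_shift => /and3P[_ _].
    by rewrite map_inj_uniq //; apply: addIn.
  have uqG : uniq (qvn G).
    by move: ok => /andP[_]; rewrite -/(qvn _) qvn_cat Eqp qvn_shift.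
  split; first by rewrite env_okE uG.
    move: pk => /= /andP[_]; rewrite all_map; apply: sub_all.
    by case=> //= xs; rewrite size_map.
  split=> //=.
  + rewrite a andbT; apply/andP; split.
      by move: pk => /= /andP[+ _]; case: (p) => //= n; rewrite size_iota.
    by apply/allP => k kp; apply: d; rewrite lv_cat Elp mem_cat kp.
  + by move: c; rewrite qvn_cat Eqp qvn_shift.
  + move=> x xG; rewrite /lin lin_down; apply: d.
    by rewrite lv_cat lv_shift mem_cat mem_map_addn xG orbT.
  + move=> b' x; rewrite mem_down => /e; rewrite cv_cat Ecp cv_shift mem_cat mem_iota add0n.
    by rewrite ltnNge leq_addl /= mem_map_addn.
- move=> G M _ [ok pk [a b c d e]].
  have uG : uniq (cv G).
    move: ok => /andP[/= /andP[_]]; rewrite -/(cv _) cv_shift.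
    by rewrite map_inj_uniq //; apply: addIn.
  have uqG : uniq (qvn G).
    by move: ok => /andP[_] /=; rewrite -/(qvn _) qvn_shift.
  split; first by rewrite env_okE uG.
    by move: pk => /=; rewrite all_map; apply: sub_all; case=> //= xs; rewrite size_map.
  split=> //=.
  + by move: c; rewrite /qvn /= -/(qvn _) qvn_shift.
  + move=> x xG; rewrite /lin lin_down; apply: d.
    by rewrite /lv /= -/(lv _) lv_shift mem_map_addn.
  + move=> b' x; rewrite mem_down => /e; rewrite /cv /= -/(cv _) cv_shift inE addn1 /= -addn1.
    by rewrite mem_map_addn.
- move=> G1 G2 M1 M2 ok _ [ok1 pk1 I1] _ [ok2 pk2 I2].
  have := @wf_tup_invariant [:: (G1, M1); (G2, M2)].
  rewrite /unzip1 /unzip2 /= cats0; case; first by case/andP: ok.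
    by case=> [|[|]].
  rewrite /= !cats0 andbT => a b c d e; split; rewrite ?all_cat ?pk1 //.
  by split=> // x /d; rewrite /lin /= cats0.
Qed.

Lemma wf_good G M : wf G M -> good M.
Proof.
move=> /wf_sound[/andP[_ uq] _ [a b c _ _]].
by rewrite /good a b (perm_uniq c).
Qed.

(** * From linearity to well-formedness *)

Definition flat_env (L B Q : seq nat) : env :=
  map ELin L ++ map EBang B ++ map EQ Q.

Lemma cv_flat L B Q : cv (flat_env L B Q) = L ++ B.
Proof. by rewrite !cv_cat cv_ELin cv_EBang cv_EQ cats0. Qed.

Lemma qvn_flat L B Q : qvn (flat_env L B Q) = Q.
Proof. by rewrite !qvn_cat qvn_ELin qvn_EBang qvn_EQ. Qed.

Lemma flat_env_ok L B Q : env_ok (flat_env L B Q) = uniq (L ++ B) && uniq Q.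
Proof. by rewrite env_okE cv_flat qvn_flat. Qed.

Lemma wf_weak_all B G M :
  env_ok (map EBang B ++ G) -> wf G M -> wf (map EBang B ++ G) M.
Proof.
elim: B => //= x B IH ok /IH H; apply: wf_weak => //; apply: H.
by move: ok; rewrite !env_okE /cv /qvn /= => /andP[/andP[_ ->] ->].
Qed.

Lemma wf_contr_all V h B G M :
  wf (map EBang V ++ map EBang B ++ G) M ->
  {in V, forall v, h v \in B} -> (forall k, k \notin V -> h k = k) ->
  wf (map EBang B ++ G) (ren h M).
Proof.
elim: V h M => [|v V IH] h M H hV hid.
  by rewrite ren_id_in // => b x _; apply: hid.
have [ok _ _] := wf_sound H.
have vB : h v \in B by apply: hV; rewrite mem_head.
have : uniq (v :: V ++ B).
  move: ok; rewrite env_okE !cv_cat !cv_EBang => /andP[+ _].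
  by rewrite catA cat_uniq => /andP[].
rewrite /= mem_cat negb_or cat_uniq => /andP[/andP[vV vNB] /and3P[uV /hasPn dVB uB]].
have vh : v != h v by apply: contraNneq vNB => ->.
(* The renaming factors as [h' \o c]: the contraction [c] identifies [v] with [h v], reusing the
   latter name, and [h'] treats the remaining variables of [V]. *)
pose c k := if k \in [:: v; h v] then h v else k.
pose h' k := if k == v then v else h k.
have pB : perm_eq (map EBang V ++ map EBang B ++ G)
    (EBang (h v) :: map EBang V ++ map EBang (rem (h v) B) ++ G).
  apply/permP => P; rewrite /= !count_cat.
  by rewrite (permP (perm_map EBang (perm_to_rem vB))) /= -!addnA addnCA.
have okz : env_ok (EBang (h v) :: map EBang V ++ map EBang (rem (h v) B) ++ G).
  rewrite -(perm_env_ok pB); move: ok; rewrite !env_okE /cv /qvn /=.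
  by case/andP => /andP[_ ->] ->.
have Hc : wf (map EBang V ++ map EBang B ++ G) (ren c M).
  apply: wf_exch (wf_contr okz _); first by rewrite perm_sym; exact: pB.
  by apply: wf_exch H; rewrite /= perm_cons.
have := IH h' _ Hc.
rewrite ren_ren (eq_ren (g := h)).
  apply=> [w wV|k kV]; rewrite /h'; case: eqP => [E|/eqP kv].
  - by move: vV; rewrite -E wV.
  - by apply: hV; rewrite inE wV orbT.
  - by [].
  - by apply: hid; rewrite inE negb_or kv.
move=> k; rewrite /= /c /h' !inE.
case: (eqVneq k v) => [->|kv] /=.
  rewrite eq_sym (negbTE vh); apply: hid; rewrite inE negb_or eq_sym vh.
  exact: (dVB _ vB).
case: (eqVneq k (h v)) => [->|kh]; last by rewrite (negbTE kv).
by rewrite eq_sym (negbTE vh).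
Qed.

(* Every variable of [ren f M] may be declared in the environment, either as
   linear if it is so in [ren f M], or as duplicable. *)
Definition flat_wf (M : term) : Prop := forall f L B,
  uniq (L ++ B) -> {in L, forall x, lin x (ren f M)} ->
  (forall b x, (b, x) \in cocc (ren f M) -> x \in L ++ B) ->
  wf (flat_env L B (qvars M)) (ren f M).

Lemma flatten_mkseq_cat (T : Type) (F : nat -> seq T) k :
  flatten (mkseq F k.+1) = flatten (mkseq F k) ++ F k.
Proof. by rewrite mkseqS -cats1 flatten_cat /= cats0. Qed.

Lemma mem_flatten_mkseq (T : eqType) (F : nat -> seq T) k x :
  reflect (exists2 i, i < k & x \in F i) (x \in flatten (mkseq F k)).
Proof.
apply: (iffP flatten_mapP) => [[j] | [j ik xF]].
  by rewrite mem_iota => /andP[_ ik] xF; exists j.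
by exists j; rewrite ?mem_iota.
Qed.

Lemma subseq_flatten_mkseq (T : eqType) (F : nat -> seq T) k i :
  i < k -> subseq (F i) (flatten (mkseq F k)).
Proof.
elim: k => // k IH; rewrite ltnS flatten_mkseq_cat leq_eqVlt => /predU1P[-> | /IH H].
  exact: suffix_subseq.
exact: subseq_trans H (prefix_subseq _ _).
Qed.

Lemma leq_sumn x s : x \in s -> x <= sumn s.
Proof.
elim: s => //= y s IH; rewrite inE => /predU1P[-> | /IH H]; first exact: leq_addr.
exact: leq_trans H (leq_addl _ _).
Qed.

Lemma map_nth_mkseq (T S : Type) (F : T -> S) x0 s :
  map F s = mkseq (fun i => F (nth x0 s i)) (size s).
Proof. by rewrite -{1}(mkseq_nth x0 s) /mkseq -map_comp. Qed.

Lemma perm_flat_env (L B Q : nat -> seq nat) k :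
  perm_eq (flatten (mkseq (fun i => flat_env (L i) (B i) (Q i)) k))
    (flat_env (flatten (mkseq L k)) (flatten (mkseq B k)) (flatten (mkseq Q k))).
Proof.
elim: k => // k IH; rewrite !flatten_mkseq_cat; apply: (perm_trans (perm_cat IH (perm_refl _))).
apply/permP => P; rewrite /flat_env !map_cat !count_cat addnACA; congr (_ + _).
by rewrite addnACA.
Qed.

(** * Splitting an environment among subterms *)

Section Split.
Variables (F : seq term -> term) (Ms : seq term).
Let k := size Ms.
(** Abstracts the two rules that split environments: [F] is the tuple, or the application of the
    first of two terms to the second. *)
Hypothesis rule : forall Gs Ts, size Gs = k -> size Ts = k ->
  env_ok (flatten Gs) ->
  (forall i, i < k -> wf (nth [::] Gs i) (nth (bit false) Ts i)) ->
  wf (flatten Gs) (F Ts).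
Hypothesis renF : forall g Ts, size Ts = k -> ren g (F Ts) = F (map (ren g) Ts).

(* The duplicable variables are renamed apart in the components, and then
   contracted. *)
Lemma wf_split f L B :
  (forall i, i < k -> flat_wf (nth (bit false) Ms i)) ->
  uniq (L ++ B) -> uniq (flatten (map qvars Ms)) ->
  {in L, forall x, occs x (flatten [seq cocc (ren f M) | M <- Ms]) == [:: (false, x)]} ->
  (forall b x, (b, x) \in flatten [seq cocc (ren f M) | M <- Ms] -> x \in L ++ B) ->
  wf (flat_env L B (flatten (map qvars Ms))) (F (map (ren f) Ms)).
Proof.
move=> wfMs uLB; rewrite !(map_nth_mkseq _ (bit false)) -/k.
set M := nth (bit false) Ms; set Q := fun i => qvars (M i) => uQ.
set c := fun i => cocc (ren f (M i)) => linL subLB.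
have [uL disj uB] : [/\ uniq L, {in B, forall x, x \notin L} & uniq B].
  by move: uLB; rewrite cat_uniq => /and3P[? /hasPn].
(* All declared variables are below [m], so [x + m * i.+1] is a fresh copy of [x] for component [i];
   division by [m] recovers [i], and the remainder is [x]. *)
set m := (sumn (L ++ B)).+1.
have ltm x : x \in L ++ B -> x < m by move/leq_sumn.
have ltmL x : x \in L -> x < m by move=> xL; apply: ltm; rewrite mem_cat xL.
have ltmB x : x \in B -> x < m by move=> xB; apply: ltm; rewrite mem_cat xB orbT.
pose g i x := if x \in B then x + m * i.+1 else x.
(* Each linear variable goes to the only component in which it occurs, so the lists [Li i] together
   form a permutation of [L]. *)
pose Li i := [seq x <- unzip2 (c i) | x \in L].
pose Bi i := map (g i) B.
have mem_c i b x : i < k -> (b, x) \in c i -> (b, x) \in flatten (mkseq c k).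
  by move=> ik xc; apply/mem_flatten_mkseq; exists i.
have LiL i x : x \in Li i -> x \in L by rewrite mem_filter => /andP[].
have eLi : flatten (mkseq Li k) = [seq x <- unzip2 (flatten (mkseq c k)) | x \in L].
  elim: (k) => // j IH; rewrite !flatten_mkseq_cat IH /unzip2 map_cat filter_cat //.
have pL : perm_eq (flatten (mkseq Li k)) L.
  rewrite eLi; apply/allP => x _ /=; apply/eqP.
  case: (boolP (x \in L)) => xL; last first.
    rewrite (count_memPn xL); apply/count_memPn; rewrite mem_filter negb_and xL //.
  rewrite (count_uniq_mem _ uL) xL count_filter count_map; transitivity 1 => //.
  have := congr1 size (eqP (linL x xL)); rewrite size_filter /= => <-.
  apply: eq_count => -[b y] /=; rewrite andb_idr // => /eqP ->; exact: xL.
have occs_c i x : i < k -> x \in Li i -> occs x (c i) = [:: (false, x)].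
  move=> ik xLi; have xL := LiL _ _ xLi; move: xLi.
  rewrite mem_filter => /andP[_ /mapP[[b y] xc /= E]].
  have : subseq (occs x (c i)) [:: (false, x)].
    rewrite -(eqP (linL x xL)) subseq_filter filter_all.
    exact: subseq_trans (filter_subseq _ _) (subseq_flatten_mkseq c ik).
  case E2: (occs x (c i)) => [|p [|q l]].
  - by move/eqP/occs_nilP: E2 => /(_ b); rewrite E xc.
  - by rewrite sub1seq inE => /eqP ->.
  - by move/size_subseq.
set V := flatten (mkseq Bi k).
have memV v : v \in V -> exists i x, [/\ i < k, x \in B & v = x + m * i.+1].
  by case/mem_flatten_mkseq=> i ik /mapP[x xB]; rewrite /g xB => ->; exists i, x.
have Vm v : v \in V -> m <= v.
  case/memV => i [x [_ _ ->]].
  by apply: leq_trans (leq_addl _ _); rewrite leq_pmulr.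
have uV : uniq V.
  rewrite /V; elim: (k) => // j IH; rewrite flatten_mkseq_cat cat_uniq IH /=; apply/andP; split.
    apply/hasPn => y /mapP[x xB ->]; apply/negP => /mem_flatten_mkseq[i ij /mapP[z zB]].
    rewrite /g xB zB => /(congr1 (fun y => y %/ m)).
    rewrite ![_ + m * _]addnC ![m * _]mulnC !divnMDl // !divn_small ?ltmB // !addn0 => -[ji].
    by rewrite ji ltnn in ij.
  rewrite map_inj_in_uniq // => x y xB yB; rewrite /g xB yB; exact: addIn.
have uLV : uniq (L ++ V).
  rewrite cat_uniq uL uV andbT /=; apply/hasPn => v /Vm mv.
  by apply/negP => /ltmL; rewrite ltnNge mv.
pose Gs := mkseq (fun i => flat_env (Li i) (Bi i) (Q i)) k.
pose Ts := mkseq (fun i => ren (g i) (ren f (M i))) k.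
have pGs : perm_eq (flatten Gs) (flat_env L V (flatten (mkseq Q k))).
  apply: (perm_trans (perm_flat_env _ _ _ _)); rewrite /flat_env perm_cat2r.
  exact: perm_map.
have memLB i b x : i < k -> (b, x) \in c i -> x \in L ++ B.
  by move=> ik xc; apply: subLB (mem_c _ _ _ ik xc).
have wfT : wf (flatten Gs) (F Ts).
  apply: rule; rewrite ?size_mkseq //.
    by rewrite (perm_env_ok pGs) flat_env_ok uLV.
  move=> i ik; rewrite !nth_mkseq // ren_ren; apply: wfMs => //.
  - rewrite cat_uniq (subseq_uniq (subseq_flatten_mkseq Li ik)) ?(perm_uniq pL) //=.
    rewrite (subseq_uniq (subseq_flatten_mkseq Bi ik)) // andbT.
    apply/hasPn => x xB; apply/negP => /LiL /ltmL; rewrite ltnNge Vm //.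
    by apply/mem_flatten_mkseq; exists i.
  - move=> x xLi; rewrite /lin -ren_ren cocc_ren occs_map_snd ?occs_c //.
    move=> b y yc; rewrite /g; case: ifP => // yB; split=> [E|E].
      have := ltmL _ (LiL _ _ xLi); rewrite -E ltnNge.
      by rewrite (leq_trans _ (leq_addl _ _)) // leq_pmulr.
    by move: (disj _ yB); rewrite E (LiL _ _ xLi).
  - move=> b x; rewrite -ren_ren cocc_ren => /mapP[[b' y] yc [_ ->]] /=.
    rewrite mem_cat; case: (boolP (y \in B)) => yB.
      by rewrite map_f ?orbT.
    rewrite /g (negbTE yB) mem_filter; move: (memLB _ _ _ ik yc).
    by rewrite mem_cat (negbTE yB) orbF => ->; rewrite (map_f snd yc).
(* The renaming back, to be realised by contractions once the original [B] has been added by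
   weakening. *)
pose h x := if x \in V then x %% m else x.
have gm i x : x \in B -> g i x %% m = x.
  by move=> xB; rewrite /g xB addnC mulnC modnMDl modn_small ?ltmB.
have <- : ren h (F Ts) = F (mkseq (fun i => ren f (M i)) k).
  rewrite renF ?size_mkseq // /Ts /mkseq -map_comp; congr F; apply/eq_in_map => i.
  rewrite mem_iota /= add0n => ik; rewrite ren_ren ren_id_in // => b x xc /=.
  have := memLB _ _ _ ik xc; rewrite mem_cat; case: (boolP (x \in B)) => xB.
    move=> _; rewrite /h ifT ?gm //; apply/mem_flatten_mkseq; exists i => //.
    exact: map_f.
  rewrite orbF /g (negbTE xB) /h => xL; case: ifP => // /Vm.
  by rewrite leqNgt ltmL.
have wfV : wf (map EBang V ++ map EBang B ++ (map ELin L ++ map EQ (flatten (mkseq Q k)))) (F Ts).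
  have p : perm_eq (map EBang B ++ flatten Gs)
      (map EBang V ++ map EBang B ++ (map ELin L ++ map EQ (flatten (mkseq Q k)))).
    rewrite perm_sym perm_catCA perm_cat2l perm_catCA perm_sym; exact: pGs.
  apply: wf_exch p _; apply: wf_weak_all wfT.
  rewrite env_okE cv_cat qvn_cat cv_EBang qvn_EBang /=.
  rewrite (perm_uniq (perm_qvn pGs)) qvn_flat uQ andbT.
  rewrite (perm_uniq (perm_cat (perm_refl B) (perm_cv pGs))) cv_flat.
  rewrite cat_uniq uB uLV andbT /=; apply/hasPn => x; rewrite mem_cat => /orP[xL|/Vm mx].
    by apply/negP => /disj; rewrite xL.
  by apply/negP => /ltmB; rewrite ltnNge mx.
apply: wf_exch (wf_contr_all (h := h) wfV _ _).
- by rewrite perm_catCA.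
- move=> v vV; rewrite /h vV; case: (memV v vV) => i [x [_ xB ->]].
  by have := gm i x xB; rewrite /g xB => ->.
- by move=> v /negbTE vV; rewrite /h vV.
Qed.

End Split.

Lemma lin_notin x M : cocc M = [::] -> lin x M = false.
Proof. by rewrite /lin => ->. Qed.

Lemma flat_wf_closed M : cocc M = [::] -> (forall f, ren f M = M) ->
  uniq (qvars M) -> wf (map EQ (qvars M)) M -> flat_wf M.
Proof.
move=> cM renM uM wM f [|x L] B; rewrite renM; last first.
  by move=> _ /(_ x (mem_head _ _)); rewrite lin_notin.
move=> uB _ _; apply: wf_weak_all => //.
by rewrite env_okE cv_cat qvn_cat cv_EBang cv_EQ cats0 qvn_EBang qvn_EQ uB.
Qed.

Lemma shift_flat_env n L B Q : map (shift_entry n) (flat_env L B Q) =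
  flat_env (map (addn^~ n) L) (map (addn^~ n) B) Q.
Proof. by rewrite /flat_env !map_cat -!map_comp. Qed.

Lemma uniq_up n l : uniq l -> uniq (iota 0 n ++ map (addn^~ n) l).
Proof.
move=> ul; rewrite cat_uniq iota_uniq map_inj_uniq ?ul ?andbT; last exact: addIn.
apply/hasPn => _ /mapP[x _ ->]; rewrite mem_iota add0n ltnNge.
by rewrite leq_addl.
Qed.

(** The generality in the renaming [f] lets [wf_split] rename the variables of subterms apart, and
    lets binders be entered with [upren]. *)
Lemma flat_wfP M : linear_term M -> all (fun p => ~~ p.1) (qocc M) ->
  uniq (qvars M) -> flat_wf M.
Proof.
elim/term_Forall_ind: M => /=.
- move=> x _ _ _ f L B; set y := f x => uLB linL /(_ false y (mem_head _ _)).
  have Ly z : z \in L -> z = y.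
    by move=> /linL; rewrite /lin /occs /= -/y; case: (eqVneq y z).
  have uL : uniq L by move: uLB; rewrite cat_uniq => /andP[].
  (* The variable is either the only element of [L], or duplicable and obtained by dereliction; the
     rest of [B] comes from weakening. *)
  rewrite mem_cat => /orP[yL|yB].
    have EL : L = [:: y].
      case: L yL uL Ly {linL uLB} => // z [|w L] _ /= uL Ly; first by rewrite (Ly z) ?mem_head.
      have Ez := Ly z (mem_head _ _).
      have Ew : w = y by apply: Ly; rewrite !inE eqxx orbT.
      by move: uL; rewrite Ez Ew inE eqxx.
    rewrite /flat_env EL in uLB *.
    apply: wf_exch (_ : perm_eq (map EBang B ++ [:: ELin y]) _) _.
      by rewrite cats0 perm_catC.
    apply: wf_weak_all (wf_var y).
    rewrite env_okE cv_cat qvn_cat cv_EBang qvn_EBang /= andbT.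
    by rewrite uniq_catC.
  have EL : L = [::].
    case: L Ly uLB {linL uL} => // z L /(_ z (mem_head _ _)) -> /= /andP[].
    by rewrite mem_cat yB orbT.
  rewrite /flat_env EL /= in uLB * ; rewrite cats0.
  have p := perm_to_rem yB.
  apply: wf_exch (_ : perm_eq (map EBang (rem y B) ++ [:: EBang y]) _) _.
    by rewrite perm_catC perm_sym (perm_map EBang p).
  apply: wf_weak_all (wf_der (wf_var y)).
  rewrite env_okE cv_cat qvn_cat cv_EBang qvn_EBang /= andbT.
  by move: uLB; rewrite uniq_catC (perm_uniq p).
- by move=> r _ _ _; apply: flat_wf_closed => //; apply: wf_qvar.
- by move=> b _ _ _; apply: flat_wf_closed => //; apply: wf_bit.
- by move=> i _ _ _; apply: flat_wf_closed => //; apply: wf_gate.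
- move=> M IH lM uM _ f [|x L] B uLB linL subLB; last first.
    (* Under a [bang] every occurrence is flagged [true], so nothing can be declared linear. *)
    move: (linL x (mem_head _ _)); rewrite /lin /= occs_mark.
    by case: (occs x _).
  have qM : qocc M = [::] by case: (qocc M) uM.
  have qvM : qvars M = [::] by rewrite qvarsE qM.
  rewrite /flat_env /= qvM cats0; apply: wf_prom.
  have := IH lM; rewrite qM qvM => /(_ isT isT f [::] B uLB).
  rewrite /flat_env /= qvM cats0; apply=> // b x xM.
  by apply: (subLB true); apply: (mem_mark1 true xM).
- move=> M IH lM uM qM f L B uLB linL subLB.
  by apply: wf_new; apply: IH.
- move=> M N IHM IHN /andP[lM lN]; rewrite all_cat cat_uniq => /andP[uM uN].
  move=> /and3P[qM qd qN] f L B uLB linL subLB.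
  have := @wf_split (fun Ts => app (nth (bit false) Ts 0) (nth (bit false) Ts 1)) [:: M; N] _ _ f L B.
  rewrite /= !cats0; apply=> //.
  + move=> [|G1 [|G2 [|]]] // [|T1 [|T2 [|]]] // _ _ /=; rewrite cats0 => ok H.
    by apply: wf_app => //; [exact: (H 0) | exact: (H 1)].
  + by move=> g [|T1 [|T2 [|]]].
  + by case=> [|[|]] //= _; [apply: IHM | apply: IHN].
  + by rewrite cat_uniq qM qd.
- move=> M IH lM uM qM f L B uLB linL subLB; apply: wf_lamb.
  rewrite shift_flat_env.
  apply: wf_exch (_ : perm_eq (flat_env (map (addn^~ 1) L) (0 :: map (addn^~ 1) B) (qvars M)) _) _.
    by apply/permP => P; rewrite /= !count_cat /= -addnA addnCA.
  apply: IH => //.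
  + have := uniq_up 1 uLB; rewrite map_cat.
    by congr is_true; apply: perm_uniq; rewrite perm_sym -cat1s perm_catCA.
  + by move=> _ /mapP[x xL ->]; have := linL x xL; rewrite /lin /= lin_down.
  + move=> b x; rewrite mem_cat inE; case: (ltn_addP 1 x) => [|[y ->]].
      by rewrite ltnS leqn0 => ->; rewrite orbT.
    by rewrite -mem_down => /subLB; rewrite !mem_map_addn mem_cat => /orP[->|->]; rewrite ?orbT.
- move=> p M IH /and3P[sp Hl lM] uM qM f L B uLB linL subLB; apply: wf_lam.
  rewrite shift_flat_env; set n := arity p.
  have wM : wf (flat_env (iota 0 n ++ map (addn^~ n) L) (map (addn^~ n) B) (qvars M))
               (ren (upren n f) M).
    apply: IH => //.
    + by rewrite -catA -map_cat uniq_up.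
    + move=> x; rewrite mem_cat mem_iota /= add0n => /orP[xn|/mapP[y yL ->]].
        rewrite /lin renE -(eq_subst _ (upsubst_var _ _)) occs_upsubst //.
        by apply: (allP Hl); rewrite mem_iota.
      by have := linL y yL; rewrite /lin /= lin_down.
    + move=> b x; rewrite -catA -map_cat mem_cat mem_iota /= add0n.
      case: (ltn_addP n x) => [-> //|[y ->]].
      by rewrite -mem_down => /subLB; rewrite mem_map_addn => ->; rewrite orbT.
  move: wM; rewrite /n; case: (p) sp => [|k] //= sk wM.
  by apply: wf_pat; rewrite ?size_iota // catA -map_cat.
- move=> Ms IH /andP[sMs lMs] uMs qMs f L B uLB linL subLB.
  apply: (@wf_split (fun Ts => tup Ts) Ms) => //.
  + move=> Gs Ts sG sT ok H.
    rewrite -(@unzip1_zip _ _ Gs Ts) ?sG ?sT // -{2}(@unzip2_zip _ _ Gs Ts) ?sG ?sT //.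
    apply: wf_tup; rewrite ?unzip1_zip ?unzip2_zip ?sG ?sT // size_zip sG sT minnn //.
  + elim: IH lMs uMs qMs {linL subLB sMs} => //= M Ms' IHM _ IHMs /andP[lM lMs].
    rewrite all_cat cat_uniq => /andP[uM uMs] /and3P[qM _ qMs] [|i]; first by move=> _; apply: IHM.
    exact: IHMs.
  + by move=> x /linL; rewrite /lin /= -map_comp.
  + by move=> b x H; apply: (subLB b); rewrite /= -map_comp.
Qed.

(** All free variables are declared duplicable, which puts no condition on their occurrences. *)
Lemma good_wf M : good M -> exists G, wf G M.
Proof.
move=> /and3P[lM uM qM]; exists (flat_env [::] (undup (unzip2 (cocc M))) (qvars M)).
have := flat_wfP lM uM qM (f := id) (L := [::]); rewrite ren_id_in //; apply=> //.
  exact: undup_uniq.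
by move=> b x xM; rewrite mem_undup (map_f snd xM).
Qed.

(** * Sorting of computations *)

Section Chains.
Variables (R : realType) (nq : nat -> nat) (U : forall i, 'M[R[i]%C]_(2 ^ nq i)).
Implicit Types A B Z : preconfig R.

Definition pstep (a : label) A B : Prop := red U a (st A) (tm A) (st B) (tm B).

Definition pgood A : Prop := good (tm A) /\ {subset qvars (tm A) <= qv (st A)}.

Lemma pgood_well_formed A : pgood A <-> well_formed A.
Proof.
split=> [[gA sA]|[sA [G /wf_good gA]]]; last by split.
by split=> //; apply: good_wf.
Qed.

Lemma pgood_tred a e S S1 M M1 : tred nq a e M M1 -> eff U e S S1 ->
  pgood (Preconfig S M) -> pgood (Preconfig S1 M1).
Proof.
move=> H He [/= gM sM]; have qM := qvars_tred H gM; split=> /=; last first.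
  move=> r; rewrite (perm_mem qM) (eff_qv He) mem_cat in_fsetU in_fset.
  by case/orP=> [->|/sM->]; rewrite ?orbT.
apply: (good_tred H gM); rewrite cat_uniq; case/and3P: gM => _ _ ->; rewrite andbT.
case: e He {H qM} => [_|i rs _|r c [rS _]] /=; try by apply/hasPn.
by apply/hasPn => x /sM; rewrite !inE => xS; apply: contraNneq rS => <-.
Qed.

Lemma pgood_pstep a A B : pstep a A B -> pgood A -> pgood B.
Proof. by case: A B => S M [S1 M1] /redP[e H He]; apply: pgood_tred H He. Qed.

Lemma pstep_qv a A B : pstep a A B -> {subset qv (st A) <= qv (st B)}.
Proof.
by move=> /redP[e _ He] r rA; rewrite (eff_qv He) in_fsetU rA orbT.
Qed.

Inductive steps : preconfig R -> preconfig R -> Prop :=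
| steps0 A : steps A A
| stepsS a A B Z : pstep a A B -> steps B Z -> steps A Z.

Lemma steps_trans A B Z : steps A B -> steps B Z -> steps A Z.
Proof. by elim=> // a {}A A' {}B H _ IH /IH; apply: stepsS H. Qed.

Lemma steps_qv A Z : steps A Z -> {subset qv (st A) <= qv (st Z)}.
Proof. by elim=> [{}A r //|a {}A B {}Z /pstep_qv H _ IH r /H/IH]. Qed.

(** The index bounds from below the rank of the first step, hence of all steps, as ranks never
    decrease. *)
Inductive sorted_steps : nat -> preconfig R -> preconfig R -> Prop :=
| sorted0 k A : sorted_steps k A A
| sortedS k a A B Z : k <= rank a -> pstep a A B ->
    sorted_steps (rank a) B Z -> sorted_steps k A Z.

Lemma sorted_steps_leq j k A Z : j <= k -> sorted_steps k A Z -> sorted_steps j A Z.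
Proof.
move=> jk H; case: H jk => [k' B|k' a B B' Z' ka HB H] jk; first exact: sorted0.
exact: sortedS (leq_trans jk ka) HB H.
Qed.

Lemma sorted_cstar S M N Z : cstar nq M N ->
  sorted_steps 0 (Preconfig S N) Z -> sorted_steps 0 (Preconfig S M) Z.
Proof.
elim=> // a {}M {}N L ra H _ IH /IH; rewrite -{1}ra.
by apply: sortedS => //; apply/redP; exists NoEffect.
Qed.

Lemma pgood_cstar S M N : cstar nq M N -> pgood (Preconfig S M) -> pgood (Preconfig S N).
Proof. by elim=> // a {}M {}N L ra H _ IH /(pgood_tred (S1 := S) H (erefl _))/IH. Qed.

(** Insertion into a sorted chain, by induction on the chain. When the new step outranks the first
    one they are exchanged, and the new step is inserted further on. The classical steps that an
    exchange may add have rank 0 and are put in front, so they need no sorting. *)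
Lemma sorted_insert k a A B Z : sorted_steps k B Z -> pgood A -> pstep a A B ->
  sorted_steps (minn k (rank a)) A Z.
Proof.
move=> H; elim: H a A => {k B Z} [k B|k b B B1 Z kb HB HZ IH] a A gA HA.
  by apply: sortedS HA (sorted0 _ _); exact: geq_minr.
case: (leqP (rank a) (rank b)) => ab.
  by apply: sortedS HA (sortedS ab HB HZ); exact: geq_minr.
have min_ab : minn (rank b) (rank a) = rank b by apply/minn_idPl/ltnW.
have lM : linear_term (tm A) by case: gA => /and3P[].
have kk : minn k (rank a) <= rank b by apply: leq_trans kb; apply: geq_minl.
apply: sorted_steps_leq kk _.
case: A B B1 HA HB gA lM HZ IH => S M [S1 M1] [S2 M2] /redP[e /= H He] /redP[e' /= H' He'] gA lM HZ IH.
case rb: (rank b) => [|[|n]].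
(* The step to pass is classical: its exchange leaves the register alone until [a] is fired. *)
- have E' : e' = NoEffect.
    by have [] := tred_rank H'; rewrite rb; case: (e').
  rewrite E' /= in H' He'; rewrite rb in ab; have [M3 H1 H2] := swap_classical H ab lM rb H'.
  apply: (sorted_cstar H1); rewrite -rb -min_ab; apply: IH; first exact: pgood_cstar H1 gA.
  by apply/redP; exists e => //=; rewrite He'.
- have Eb : b = New by case: (b) rb.
  rewrite Eb in H' ab; have [M3 H1 H2] := swap_New H ab lM H'.
  have [r [c Ee']] : exists r c, e' = Create r c.
    by have [] := tred_rank H'; case: (e') => [_ /(_ erefl)|//|r c _ _]; last by exists r, c.
  rewrite Ee' in H' H1 He'.
  have [|S3 HS1 HS2] := eff_Create_swap (e := e) _ He He'.
    case: (e) H => // [i rs /tred_Apply sub|r' c' /tred_rank[ra _]].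
      by move=> x /sub; case: gA => _; apply.
    by rewrite ra in ab.
  rewrite -rb; apply: (@sortedS _ b _ (Preconfig S3 M3)) => //.
    by rewrite Eb; apply/redP; exists (Create r c).
  rewrite -{1}min_ab; apply: IH; first exact: pgood_tred H1 HS1 gA.
  by apply/redP; exists e.
(* No rank exceeds 2, so a quantum step is never to be passed. *)
- by move: ab; rewrite rb; case: (a).
Qed.

Lemma sorted_of_steps A Z : steps A Z -> pgood A -> sorted_steps 0 A Z.
Proof.
elim=> [{}A|a {}A B {}Z H _ IH] gA; first exact: sorted0.
by have := sorted_insert (IH (pgood_pstep H gA)) gA H; rewrite min0n.
Qed.

(** * Renaming whole chains of steps *)

Definition qren_config th A : preconfig R :=
  Preconfig (qren_state th (st A)) (qren th (tm A)).

Lemma cequivP A B : cequiv A B <->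
  exists2 th, {in qv (st A) &, injective th} & B = qren_config th A.
Proof.
split=> [[th [inj Eq Er Et]]|[th inj ->]].
  exists th => //; case: B Eq Er Et => T N /= Eq Er ->; congr Preconfig.
  by apply: qstateP => // a; rewrite Er reg_qren_state.
by exists th; split=> // a; rewrite reg_qren_state.
Qed.

Lemma cequiv_refl A : cequiv A A.
Proof.
exists id; split=> //; first by rewrite imfset_id.
by elim/term_cons_ind: (tm A) => //= [M <-|M <-|M N <- <-|M <-|p M <-|M Ms <- [<-]].
Qed.

Lemma cequiv_trans A B Z : cequiv A B -> cequiv B Z -> cequiv A Z.
Proof.
move=> [th [inj Eq Er Et]] [th' [inj' Eq' Er' Et']]; exists (th' \o th); split.
- by move=> x y xA yA /= /inj' E; apply: inj => //; apply: E; rewrite Eq in_imfset.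
- rewrite Eq' Eq; apply/fsetP => x; apply/imfsetP/imfsetP => /=.
    by case=> _ /imfsetP[y /= yA ->] ->; exists y.
  by case=> y yA ->; exists (th y) => //; rewrite in_imfset.
- by move=> a; rewrite Er' Er.
- rewrite Et' Et; elim/term_cons_ind: (tm A) => //= [M ->|M ->|M N -> ->|M ->|p M ->|M Ms -> [->]] //.
Qed.

Lemma pstep_qren th a A B : {in qv (st B) &, injective th} -> pgood A ->
  pstep a A B -> pstep a (qren_config th A) (qren_config th B).
Proof.
move=> inj [_ sA] /redP[e H He]; apply/redP; exists (qren_effect th e); first exact: tred_qren.
apply: eff_qren => //; case: e H {He} => // i rs /tred_Apply sub r /sub; exact: sA.
Qed.

(** Sets of quantum variables only grow along a chain, so injectivity at its end gives injectivity
    throughout. *)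
Lemma steps_qren th A Z : {in qv (st Z) &, injective th} -> pgood A ->
  steps A Z -> steps (qren_config th A) (qren_config th Z).
Proof.
move=> inj gA H; elim: H inj gA => [{}A|a {}A B {}Z HB HZ IH] inj gA; first exact: steps0.
apply: stepsS (pstep_qren _ gA HB) (IH inj (pgood_pstep HB gA)).
by apply: sub_in2 inj; apply: steps_qv.
Qed.

Lemma pgood_qren th A : {in qv (st A) &, injective th} -> pgood A -> pgood (qren_config th A).
Proof.
move=> inj [gA sA]; split=> /=; first by apply: good_qren => //; apply: sub_in2 inj.
by move=> r; rewrite qvars_qren => /mapP[s /sA sS ->]; rewrite in_imfset.
Qed.

Lemma config_good (C : config R) : pgood C.
Proof. by apply/pgood_well_formed; case: C. Qed.

(* Renamings of quantum variables are pushed back to the first configuration. *)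
Lemma steps_of_computation (C : nat -> config R) n :
  (forall i, 0 < i -> i < n.+1 -> step U (C i.-1) (C i)) ->
  exists A, [/\ cequiv (C 0) A, pgood A & steps A (C n)].
Proof.
elim: n => [_|n IH H].
  by exists (C 0); split; [exact: cequiv_refl | exact: config_good | exact: steps0].
have [|A [CA gA HA]] := IH; first by move=> i i0 lin; apply: H => //; apply: ltnW.
have [a [C1 [D1 [_ /cequivP[th inj E1] H1 /cequivP[th' inj' E2]]]]] := H n.+1 isT (ltnSn _).
rewrite /= in inj E1.
have injA : {in qv (st A) &, injective th} by apply: sub_in2 inj; apply: steps_qv.
have gA' := pgood_qren injA gA.
have HD : steps (qren_config th A) D1.
  apply: steps_trans (steps_qren inj gA HA) _.
  by rewrite -E1; apply: stepsS H1 (steps0 _).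
have injA' : {in qv (st (qren_config th A)) &, injective th'}.
  by apply: sub_in2 inj'; apply: steps_qv.
exists (qren_config th' (qren_config th A)); split.
- apply: cequiv_trans CA _; apply: cequiv_trans (_ : cequiv A (qren_config th A)) _.
    by apply/cequivP; exists th.
  by apply/cequivP; exists th'.
- exact: pgood_qren.
- by rewrite E2; apply: steps_qren.
Qed.

(** The last clause, on the first label, is what the induction needs when a step is prepended. *)
Lemma sorted_steps_fun k A Z : sorted_steps k A Z -> pgood A ->
  exists n (f : nat -> config R) (l : nat -> label),
    [/\ f 0 = A :> preconfig R, f n = Z :> preconfig R,
        forall i, i < n -> pstep (l i) (f i) (f i.+1),
        forall i, i.+1 < n -> rank (l i) <= rank (l i.+1) &
        0 < n -> k <= rank (l 0)].
Proof.
elim=> {k A Z} [k A|k a A B Z ka HA _ IH] gA.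
  by exists 0, (fun=> Config (proj1 (pgood_well_formed A) gA)), (fun=> Uq).
have [n [f [l [f0 fn fS lS l0]]]] := IH (pgood_pstep HA gA).
exists n.+1, (fun i => if i is j.+1 then f j else Config (proj1 (pgood_well_formed A) gA)).
exists (fun i => if i is j.+1 then l j else a); split=> //.
- by case=> [_|i]; [rewrite /= f0 | exact: fS].
- by case=> [|i]; [exact: l0 | exact: lS].
Qed.

End Chains.

(** * Steps with labels of different ranks have different outcomes *)

(** Marks the nodes of the kind that a step labelled [a] destroys; commuting conversions destroy
    none. *)
Definition consumed (a : label) (M : term) : nat :=
  match a, M with
  | Uq, gate _ | New, new _ | Cbeta, lamb _
  | Lbeta, lam PVar _ | Qbeta, lam (PTup _) _ => 1
  | _, _ => 0
  end.

Fixpoint cnt (a : label) (M : term) : nat :=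
  consumed a M +
  match M with
  | var _ | qvar _ | bit _ | gate _ => 0
  | bang N | new N | lamb N | lam _ N => cnt a N
  | app N L => cnt a N + cnt a L
  | tup Ms => sumn (map (cnt a) Ms)
  end.

Lemma cnt_ren a f M : cnt a (ren f M) = cnt a M.
Proof.
elim/term_cons_ind: M f => //= [M IH f|M IH f|M N IHM IHN f|M IH f|p M IH f|M Ms IHM IHMs f];
  rewrite ?IH ?IHM ?IHN //.
by have := IHMs f; case: (a) => /=; rewrite !add0n => ->.
Qed.

Lemma cnt_qren a th M : cnt a (qren th M) = cnt a M.
Proof.
elim/term_cons_ind: M => //= [M IH|M IH|M N IHM IHN|M IH|p M IH|M Ms IHM IHMs];
  rewrite ?IH ?IHM ?IHN //.
by have := IHMs; case: (a) => /=; rewrite !add0n => ->.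
Qed.

Lemma cnt_subst a s M :
  cnt a (subst s M) = cnt a M + sumn [seq cnt a (s p.2) | p <- cocc M].
Proof.
have up n t l : sumn [seq cnt a (upsubst n t p.2) | p <- l] =
    sumn [seq cnt a (t p.2) | p <- down n l].
  elim: l => //= -[b k] l IH; rewrite IH down_cons /=.
  case: (ltn_addP n k) => [kn|[j ->]].
    by rewrite upsubst_lt // leqNgt kn; case: (a).
  by rewrite leq_addl /= addnK upsubst_ge /shift cnt_ren.
elim/term_cons_ind: M s => //= [x s|r s|b s|i s|M IH s|M IH s|M N IHM IHN s|M IH s|p M IH s|s|M Ms IHM IHMs s];
  rewrite ?IH ?IHM ?IHN ?up ?map_mark ?map_cat ?sumn_cat ?addn0 ?addnA //.
- by case: (a).
- by rewrite -!addnA; congr (_ + (_ + _)); rewrite addnCA.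
- have := IHMs s; case: (a) => /=; rewrite !add0n => ->; lia.
Qed.

Lemma cnt_inst a M N :
  cnt a (inst [:: N] M) = cnt a M + size (occs 0 (cocc M)) * cnt a N.
Proof.
rewrite /inst cnt_subst; congr (_ + _); elim: (cocc M) => //= -[b [|k]] l IH.
  by rewrite /= IH.
by rewrite /= nth_default ?IH //; case: (a).
Qed.

Lemma cnt_inst_qvar a M rs : cnt a (inst (map qvar rs) M) = cnt a M.
Proof.
rewrite /inst cnt_subst; elim: (cocc M) => [|-[b k] l IH] /=; first by rewrite addn0.
have := inst_names rs k; by case: (nth _ _ _) => //= [x|r] _; rewrite -[RHS]IH; case: (a).
Qed.

Definition spent (a b : label) : nat :=
  match a, b with
  | Uq, Uq | New, New | Cbeta, Cbeta | Lbeta, Lbeta | Qbeta, Qbeta => 1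
  | _, _ => 0
  end.

Definition is_beta (a : label) : bool :=
  match a with Lbeta | Cbeta => true | _ => false end.

(* A step labelled [a] changes the numbers of nodes from [f] to [g]; for a beta
   step, an argument with [c b] nodes of each kind is replaced by [m] copies. *)
Definition delta (a : label) (f g : label -> nat) : Prop :=
  exists (m : nat) (c : label -> nat), (~~ is_beta a -> forall b, c b = 0) /\
    forall b, g b + c b + spent a b = f b + m * c b.

Lemma delta_ctx a f g f' g' (k : label -> nat) :
  (forall b, f' b = k b + f b) -> (forall b, g' b = k b + g b) ->
  delta a f g -> delta a f' g'.
Proof.
move=> Ef Eg [m [c [c0 H]]]; exists m, c; split=> // b.
by have := H b; rewrite Ef Eg; lia.
Qed.

Lemma delta_tred nq a e M M' : tred nq a e M M' -> delta a (cnt^~ M) (cnt^~ M').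
Proof.
have d0 a' f g : (forall b, g b + spent a' b = f b) -> delta a' f g.
  by move=> H; exists 0, (fun=> 0); split=> // b; rewrite !addn0 H.
have cnt_qvars b rs : sumn (map (cnt b) (map qvar rs)) = 0.
  by elim: rs => //= r rs ->; case: b.
elim=> {a e M M'}.
- by move=> i rs _; apply: d0 => b /=; rewrite cnt_qvars; case: b.
- by move=> r c; apply: d0 => -[].
(* The number of copies is the number of occurrences of the bound variable, and the argument [N] is
   what is copied. *)
- move=> M N; exists (size (occs 0 (cocc M))), (cnt^~ N); split=> // b.
  by rewrite cnt_inst /=; case: b => /=; lia.
- move=> n M rs _; apply: d0 => b; rewrite cnt_inst_qvar /= cnt_qvars; case: b => /=; lia.
- move=> M N; exists (size (occs 0 (cocc M))), (cnt^~ N); split=> // b.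
  by rewrite cnt_inst /=; case: b => /=; lia.
- by move=> L p M N; apply: d0 => b /=; rewrite cnt_ren; case: b; case: p => *; rewrite /=; lia.
- by move=> L p M N; apply: d0 => b /=; rewrite cnt_ren; case: b; case: p => *; rewrite /=; lia.
- move=> a e M M' Ms1 Ms2 _.
  apply: (delta_ctx (k := fun b => sumn (map (cnt b) Ms1) + sumn (map (cnt b) Ms2))) => b /=;
    by rewrite map_cat sumn_cat; case: b => /=; lia.
- move=> a e M M' N _.
  by apply: (delta_ctx (k := fun b => cnt b N)) => b; case: b => /=; lia.
- move=> a e M N N' _.
  by apply: (delta_ctx (k := fun b => cnt b M)) => b; case: b => /=; lia.
- move=> a e M M' _.
  by apply: (delta_ctx (k := fun b => consumed b (new M))) => b; case: b => /=; lia.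
- move=> a e M M' _.
  by apply: (delta_ctx (k := fun b => consumed b (lamb M))) => b; case: b => /=; lia.
- move=> a e p M M' _.
  by apply: (delta_ctx (k := fun b => consumed b (lam p M))) => b; case: b => /=; case: p => *; lia.
Qed.

(** If [a'] had the larger rank it would not be a beta label, so for all [b],
    [c b + spent a b = spent a' b + m * c b]. At [b = a'] this reads [c a' = 1 + m * c a'], which
    forces [m = 0] and [c a' = 1], so [a] is a beta label. At [b = a] it then reads [c a + 1 = 0],
    which is absurd. *)
Lemma delta_rank a a' f g : delta a f g -> delta a' f g -> rank a' <= rank a.
Proof.
move=> [m [c [c0 H]]] [m' [c' [c0' H']]]; rewrite leqNgt; apply/negP => aa'.
have {c0'} c0' b : c' b = 0 by apply: c0'; move: aa'; case: (a').
have {H H'} E b : c b + spent a b = spent a' b + m * c b.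
  by have := H b; have := H' b; rewrite c0'; lia.
have saa' : spent a a' = 0 by move: aa'; case: (a); case: (a').
have sa'a : spent a' a = 0 by move: aa'; case: (a); case: (a').
have sa'a' : spent a' a' = 1 by move: aa'; case: (a').
have Ea' := E a'; have Ea := E a; rewrite saa' sa'a' in Ea'; rewrite sa'a in Ea.
have m0 : m = 0 by case: (m) Ea' => // k; rewrite mulSn; lia.
have ba : is_beta a by apply/negPn/negP => /c0 c0a; move: Ea'; rewrite c0a m0.
have saa : spent a a = 1 by case: (a) ba.
by move: Ea; rewrite saa m0; lia.
Qed.

Lemma delta_step (R : realType) (nq : nat -> nat) (U : forall i, 'M[R[i]%C]_(2 ^ nq i))
    (P : pred label) (C D : config R) :
  step_in U P C D -> exists2 a, P a & delta a (cnt^~ (tm C)) (cnt^~ (tm D)).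
Proof.
move=> [a [C1 [D1 [Pa /cequivP[th _ E1] /redP[e H _] /cequivP[th' _ E2]]]]].
exists a => //; have [m [c [c0 Hc]]] := delta_tred H; exists m, c; split=> // b.
by rewrite E2 /= cnt_qren Hc E1 /= cnt_qren.
Qed.

(** Any other step between the same configurations yields a [delta] on the same counts, so
    [delta_rank] compares its label with [a]. *)
Lemma pstep_rank (R : realType) (nq : nat -> nat) (U : forall i, 'M[R[i]%C]_(2 ^ nq i))
    (P : pred label) k a (C D : config R) :
  (forall b, P b = (k <= rank b)) -> pstep U a C D -> step_in U P C D <-> k <= rank a.
Proof.
move=> Pk H; split=> [/delta_step[b]|ka]; last first.
  by exists a, C, D; split=> //; [rewrite Pk | exact: cequiv_refl | exact: cequiv_refl].
rewrite Pk => kb Hb; apply: leq_trans kb _; move: H => /redP[e /delta_tred Ha _].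
exact: delta_rank Ha Hb.
Qed.

Theorem mainTheorem11 (R : realType)
    (nq : nat -> nat) (U : forall i : nat, 'M[R[i]]_(2 ^ nq i))
    (U_unitary : forall i : nat, U i \is unitarymx)
    (U_effective : effective_enumeration U)
    (phi : nat) (C : nat -> config R) :
  computation U (Some phi) C ->
  exists (xi : nat) (C' : nat -> config R),
    CNQ_computation U (Some xi) C' /\
    cequiv (C 0) (C' 0) /\
    cequiv (C phi.-1) (C' xi.-1).
Proof.
case: phi => [[_ []] //|n] [HC [_ normC]].
have [A [CA gA HA]] := steps_of_computation HC.
have [k [f [l [f0 fk fS lS _]]]] := sorted_steps_fun (sorted_of_steps HA gA) gA.
exists k.+1, f; split; last by rewrite f0 fk; split=> //; exact: cequiv_refl.
have ranked (P : pred label) j i : (forall b, P b = (j <= rank b)) -> i.+1 < k ->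
    step_in U P (f i) (f i.+1) -> step_in U P (f i.+1) (f i.+2).
  move=> Pj ik /(pstep_rank Pj (fS i (ltnW ik))) ji.
  by apply/(pstep_rank Pj (fS i.+1 ik)); apply: leq_trans ji (lS i ik).
split.
  split=> [[|i] //= _ ik|].
    by apply/(pstep_rank (k := 0) (fun=> erefl) (fS i ik)).
  (* The two last configurations have the same underlying [preconfig], the only part that steps see,
     so normality carries over. *)
  split=> // -[D HD]; apply: normC; exists D; move: HD; rewrite /step /step_in /= fk.
  exact.
(* [label_nC] holds from rank 1 on, and [label_Q] from rank 2 on. *)
by case=> [|i] // _ ik; split; [apply: (ranked _ 1) | apply: (ranked _ 2)]; rewrite // => -[].
Qed.
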